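(* For every $t\in 2\mathbb{N}$, every integer $K\ge 0$ and every $z\in\mathbb{C}$, we have $$ \Lambda_{t,0}(z)=\frac{z^t}{t!}+(-1)^{t/2}\frac{2}{\pi^{t+1}}\sum_{k=1}^{K}\frac{1}{k^{t+1}}\sin(k\pi z)-\frac{1}{2\pi \mathrm{i}}\int_{|\zeta|=(2K+1)\pi/2}\zeta^{-t-1}\sinh(\zeta z)\coth(\zeta)\,\mathrm{d}\zeta . $$
   Context: $2\mathbb{N}=\{0,2,4,\dots\}$ denotes the set of even nonnegative integers, and $f^{(\tau)}$ denotes the $\tau$-th derivative of $f$. For each $t\in 2\mathbb{N}$, the Lidstone polynomial $\Lambda_{t,0}\in\mathbb{C}[z]$ is the unique polynomial satisfying $\Lambda_{t,0}^{(\tau)}(0)=\delta_{t,\tau}$ (Kronecker symbol) and $\Lambda_{t,0}^{(\tau)}(1)=0$ for all $\tau\in 2\mathbb{N}$. The circle $|\zeta|=(2K+1)\pi/2$ is traversed once counterclockwise. For $K=0$ the sum over $k$ is empty, hence equal to $0$. *)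

(* Defs.v *)
From Stdlib Require Import Reals Lra Lia Arith ClassicalEpsilon FunctionalExtensionality.
From Coquelicot Require Export Coquelicot.

Open Scope C_scope.

(** * Complex elementary functions *)

(** e^{x + iy} = e^x (cos y + i sin y). *)
Definition Cexp (z : C) : C :=
  ((exp (Re z) * cos (Im z))%R, (exp (Re z) * sin (Im z))%R).

Definition Csinh (z : C) : C := (Cexp z - Cexp (- z)) / 2.
Definition Ccosh (z : C) : C := (Cexp z + Cexp (- z)) / 2.
Definition Ccoth (z : C) : C := Ccosh z / Csinh z.
Definition Csin (z : C) : C := (Cexp (Ci * z) - Cexp (- (Ci * z))) / (2 * Ci).

(** * Contour integral over the circle |zeta| = r

    Parametrization zeta = r e^{i theta}, d zeta = i zeta d theta; [RInt] is
    the Riemann integral of a function from R to the real Banach space C. *)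
Definition circle_int (f : C -> C) (r : R) : C :=
  RInt (V := C_R_CompleteNormedModule)
    (fun theta : R =>
       let zeta := r * Cexp (Ci * theta) in f zeta * (Ci * zeta))
    0 (2 * PI).

(** * Lidstone polynomials *)

Definition poly_fun (a : nat -> C) (n : nat) (z : C) : C :=
  sum_n (fun k => a k * z ^ k) n.

(** As C is infinite, C[z] is identified with the polynomial functions. *)
Definition is_polynomial (P : C -> C) : Prop :=
  exists (n : nat) (a : nat -> C), forall z : C, P z = poly_fun a n z.

(** [C_derive f z] is the complex derivative as soon as [f] is complex
    differentiable at [z] ([is_C_derive_unique]), so in particular for every
    polynomial ([is_derive_poly_fun] below). *)
Fixpoint C_derive_n (n : nat) (f : C -> C) : C -> C :=
  match n with
  | O => f
  | S m => C_derive (C_derive_n m f)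
  end.

Definition is_Lidstone0 (t : nat) (P : C -> C) : Prop :=
  is_polynomial P /\
  forall tau : nat, Nat.Even tau ->
    C_derive_n tau P 0 = (if Nat.eqb t tau then 1 else 0) /\
    C_derive_n tau P 1 = 0.

(** The polynomial Lambda_{t,0}; [Lidstone0_exists_unique] below shows that
    for even [t] the description determines it. *)
Definition Lidstone0 (t : nat) : C -> C :=
  epsilon (inhabits (fun _ : C => RtoC 0)) (is_Lidstone0 t).

(** ** Existence and uniqueness *)

(** Lets [ring] see [C] where Coquelicot's canonical structures display it as
    a projection. *)
Local Ltac cring :=
  match goal with |- @eq _ ?a ?b => change (@eq C a b); simpl; ring end.

(** Coquelicot has two non-convertible normed modules C over the field C;
    they have the same norm, hence the same derivatives. *)
Lemma is_derive_C_AbsRing (f : C -> C) (z l : C) :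
  is_derive (K := C_AbsRing) (V := C_NormedModule) f z l <->
  is_derive (K := C_AbsRing) (V := AbsRing_NormedModule C_AbsRing) f z l.
Proof.
split; intros [[A B [M H]] D];
  (split; [split; [exact A | exact B | exists M; exact H]
          | intros x Hx e; exact (D x Hx e)]).
Qed.

Lemma is_derive_monomial (c : C) (n : nat) (z : C) :
  is_derive (K := C_AbsRing) (V := C_NormedModule)
    (fun x : C => c * x ^ S n) z (INR (S n) * c * z ^ n).
Proof.
induction n as [|n IH].
- apply (is_derive_ext (K := C_AbsRing) (V := C_NormedModule)
           (fun x : C => x * c)).
  { intro x; cring. }
  replace (INR 1 * c * z ^ 0) with (RtoC 1 * c) by (simpl; ring).
  exact (is_derive_scal_l (K := C_AbsRing) (V := C_NormedModule)
           (fun x => x) z (RtoC 1) c (is_derive_id (K := C_AbsRing) z)).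
- apply (is_derive_ext (K := C_AbsRing) (V := C_NormedModule)
           (fun x : C => x * (c * x ^ S n))).
  { intro x; cring. }
  replace (INR (S (S n)) * c * z ^ S n)
    with (RtoC 1 * (c * z ^ S n) + z * (INR (S n) * c * z ^ n)).
  2:{ rewrite (S_INR (S n)), RtoC_plus; simpl; ring. }
  apply is_derive_C_AbsRing in IH.
  apply is_derive_C_AbsRing.
  exact (is_derive_mult (K := C_AbsRing) (fun x => x)
           (fun x : C => c * x ^ S n) z (RtoC 1) (INR (S n) * c * z ^ n)
           (is_derive_id (K := C_AbsRing) z) IH Cmult_comm).
Qed.

Lemma poly_fun_S (a : nat -> C) (n : nat) (z : C) :
  poly_fun a (S n) z = poly_fun a n z + a (S n) * z ^ S n.
Proof. exact (sum_Sn (fun k => a k * z ^ k) n). Qed.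

Lemma poly_fun_0 (a : nat -> C) (z : C) : poly_fun a 0 z = a O.
Proof. unfold poly_fun; rewrite sum_O; cring. Qed.

Definition deriv_coef (a : nat -> C) (k : nat) : C := INR (S k) * a (S k).

Lemma is_derive_poly_fun (a : nat -> C) (n : nat) (z : C) :
  is_derive (K := C_AbsRing) (V := C_NormedModule) (poly_fun a (S n)) z
    (poly_fun (deriv_coef a) n z).
Proof.
induction n as [|n IH].
- apply (is_derive_ext (K := C_AbsRing) (V := C_NormedModule)
           (fun x : C => a O + a 1%nat * x ^ 1)).
  { intro x; rewrite poly_fun_S, poly_fun_0; reflexivity. }
  replace (poly_fun (deriv_coef a) 0 z)
    with (RtoC 0 + INR 1 * a 1%nat * z ^ 0).
  2:{ rewrite poly_fun_0; unfold deriv_coef; simpl; ring. }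
  exact (is_derive_plus (K := C_AbsRing) (V := C_NormedModule) _ _ _ _ _
           (is_derive_const (K := C_AbsRing) (V := C_NormedModule) (a O) z)
           (is_derive_monomial (a 1%nat) 0 z)).
- apply (is_derive_ext (K := C_AbsRing) (V := C_NormedModule)
           (fun x : C => poly_fun a (S n) x + a (S (S n)) * x ^ S (S n))).
  { intro x; rewrite (poly_fun_S a (S n)); reflexivity. }
  rewrite poly_fun_S.
  exact (is_derive_plus (K := C_AbsRing) (V := C_NormedModule) _ _ _ _ _ IH
           (is_derive_monomial (a (S (S n))) (S n) z)).
Qed.

Lemma C_derive_poly_fun (a : nat -> C) (n : nat) :
  C_derive (poly_fun a (S n)) = poly_fun (deriv_coef a) n.
Proof.
apply functional_extensionality; intro z.
apply is_C_derive_unique, is_derive_poly_fun.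
Qed.

Lemma C_derive_const (c : C) : C_derive (fun _ => c) = (fun _ => RtoC 0).
Proof.
apply functional_extensionality; intro z; apply is_C_derive_unique.
exact (is_derive_const (K := C_AbsRing) (V := C_NormedModule) c z).
Qed.

Lemma C_derive_n_S (n : nat) (f : C -> C) :
  C_derive_n (S n) f = C_derive_n n (C_derive f).
Proof. induction n as [|n IH]; [reflexivity | simpl in *; now rewrite IH]. Qed.

Lemma C_derive_n_zero (n : nat) :
  C_derive_n n (fun _ => RtoC 0) = (fun _ => RtoC 0).
Proof.
induction n as [|n IH]; [reflexivity | simpl; rewrite IH; apply C_derive_const].
Qed.

Lemma poly_fun_const (a : nat -> C) : poly_fun a 0 = (fun _ => a O).
Proof. apply functional_extensionality; intro z; apply poly_fun_0. Qed.

Lemma C_derive_n_poly_minus (tau n : nat) (a b : nat -> C) (z : C) :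
  C_derive_n tau (poly_fun (fun k => a k - b k) n) z =
  C_derive_n tau (poly_fun a n) z - C_derive_n tau (poly_fun b n) z.
Proof.
revert n a b; induction tau as [|tau IH]; intros n a b.
- simpl; induction n as [|n IHn].
  + rewrite !poly_fun_0; reflexivity.
  + rewrite !poly_fun_S, IHn; ring.
- rewrite !C_derive_n_S; destruct n as [|n].
  + rewrite !poly_fun_const, !C_derive_const, !C_derive_n_zero; ring.
  + rewrite !C_derive_poly_fun, <- IH; do 2 f_equal.
    apply functional_extensionality; intro k; unfold deriv_coef; ring.
Qed.

Lemma INR_S_neq0 (n : nat) : RtoC (INR (S n)) <> 0.
Proof. intro H; apply RtoC_inj in H; now apply (not_0_INR (S n)). Qed.

Lemma poly_fun_head (c : nat -> C) (n : nat) (z : C) :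
  poly_fun c (S (S n)) z =
  c O + c 1%nat * z + sum_n (fun k => c (S (S k)) * z ^ S (S k)) n.
Proof.
induction n as [|n IH].
- rewrite !poly_fun_S, poly_fun_0, sum_O; cring.
- rewrite poly_fun_S, IH, sum_Sn.
  match goal with |- _ + ?A + ?B = _ => change (plus A B) with (A + B) end.
  cring.
Qed.

Lemma sum_n_C0 (n : nat) : sum_n (fun _ => RtoC 0) n = RtoC 0.
Proof.
induction n as [|n IH]; [apply sum_O | rewrite sum_Sn, IH; exact (Cplus_0_l 0)].
Qed.

Lemma poly_fun_low (c : nat -> C) (n : nat) (z : C) :
  (forall k, (k <= n)%nat -> c (S (S k)) = 0) ->
  poly_fun c (S (S n)) z = c O + c 1%nat * z.
Proof.
intro H; rewrite poly_fun_head.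
rewrite (sum_n_ext_loc _ (fun _ => RtoC 0)).
- rewrite sum_n_C0; ring.
- intros k Hk; rewrite H by exact Hk; cring.
Qed.

Lemma lidstone_vanish (n : nat) (c : nat -> C) :
  (forall tau, Nat.Even tau -> C_derive_n tau (poly_fun c n) 0 = 0 /\
                               C_derive_n tau (poly_fun c n) 1 = 0) ->
  forall k, (k <= n)%nat -> c k = 0.
Proof.
revert c; induction n as [n IH] using lt_wf_ind; intros c H k Hk.
destruct (H O) as [H0 H1]; [now exists O | simpl in H0, H1].
destruct n as [|[|n]].
- rewrite poly_fun_0 in H0; now replace k with O by lia.
- rewrite poly_fun_S, poly_fun_0 in H0, H1.
  assert (c0 : c O = 0) by (rewrite <- H0; cring).
  destruct k as [|[|k]]; [exact c0 | | lia].
  rewrite <- H1, c0; cring.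
- assert (high : forall j, (j <= n)%nat -> c (S (S j)) = 0).
  { intros j Hj.
    assert (D : deriv_coef (deriv_coef c) j = 0).
    { apply (IH n); [lia | | exact Hj].
      intros tau [m ->].
      destruct (H (S (S (2 * m)))) as [A B]; [exists (S m); lia |].
      rewrite !C_derive_n_S, !C_derive_poly_fun in A, B; now split. }
    unfold deriv_coef in D.
    destruct (Ceq_dec (c (S (S j))) 0) as [E | E]; [exact E |].
    exfalso; revert D; repeat apply Cmult_neq_0; auto using INR_S_neq0. }
  rewrite poly_fun_low in H0, H1 by exact high.
  assert (c0 : c O = 0) by (rewrite <- H0; cring).
  destruct k as [|[|k]]; [exact c0 | | apply high; lia].
  rewrite <- H1, c0; cring.
Qed.

Lemma poly_fun_pad (a : nat -> C) (n m : nat) (z : C) :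
  poly_fun (fun k => if Nat.leb k n then a k else 0) (n + m) z = poly_fun a n z.
Proof.
induction m as [|m IH].
- rewrite Nat.add_0_r; unfold poly_fun; apply sum_n_ext_loc; intros k Hk.
  now rewrite (proj2 (Nat.leb_le k n) Hk).
- rewrite Nat.add_succ_r, poly_fun_S, IH.
  rewrite (proj2 (Nat.leb_gt (S (n + m)) n)) by lia; cring.
Qed.

Lemma is_Lidstone0_unique (t : nat) (P Q : C -> C) :
  is_Lidstone0 t P -> is_Lidstone0 t Q -> P = Q.
Proof.
intros [[n [a HP]] DP] [[m [b HQ]] DQ].
set (a' := fun k => if Nat.leb k n then a k else 0).
set (b' := fun k => if Nat.leb k m then b k else 0).
assert (EP : P = poly_fun a' (n + m)).
{ apply functional_extensionality; intro z; unfold a'.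
  now rewrite poly_fun_pad. }
assert (EQ : Q = poly_fun b' (n + m)).
{ apply functional_extensionality; intro z; unfold b'.
  now rewrite Nat.add_comm, poly_fun_pad. }
assert (V : forall k, (k <= n + m)%nat -> a' k - b' k = 0).
{ apply (lidstone_vanish (n + m) (fun k => a' k - b' k)); intros tau Htau.
  rewrite !C_derive_n_poly_minus, <- EP, <- EQ.
  destruct (DP tau Htau) as [-> ->], (DQ tau Htau) as [-> ->]; split; cring. }
rewrite EP, EQ; apply functional_extensionality; intro z.
unfold poly_fun; apply sum_n_ext_loc; intros k Hk.
replace (a' k) with (a' k - b' k + b' k) by cring.
rewrite (V k Hk); cring.
Qed.

(** Coefficients of the polynomial Q with Q'' = P and Q(0) = Q(1) = 0, where P
    has the coefficients [a] up to degree [n]. *)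
Definition lid_coef (n : nat) (a : nat -> C) (k : nat) : C :=
  let b j := a j / (INR (S j) * INR (S (S j))) in
  match k with
  | O => 0
  | 1%nat => - sum_n b n
  | S (S j) => b j
  end.

Lemma is_Lidstone0_exists (m : nat) :
  exists P : C -> C, is_Lidstone0 (2 * m) P.
Proof.
induction m as [|m [P [[n [a HP]] DP]]].
- set (a := fun k : nat => match k with O => RtoC 1 | _ => Copp (RtoC 1) end).
  exists (poly_fun a 1); split; [now exists 1%nat, a |].
  intros tau [[|j] ->]; simpl Nat.eqb; cbv iota.
  + simpl; rewrite !poly_fun_S, !poly_fun_0; simpl; split; cring.
  + replace (2 * S j)%nat with (S (S (2 * j))) by lia.
    rewrite !C_derive_n_S, C_derive_poly_fun, poly_fun_const, C_derive_const,
      C_derive_n_zero.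
    split; reflexivity.
- exists (poly_fun (lid_coef n a) (S (S n))).
  split; [now exists (S (S n)), (lid_coef n a) |].
  intros tau [[|j] ->].
  + replace (Nat.eqb (2 * S m) (2 * 0)) with false.
    2:{ symmetry; apply Nat.eqb_neq; lia. }
    simpl C_derive_n; rewrite !poly_fun_head; split.
    * rewrite (sum_n_ext (fun k => lid_coef n a (S (S k)) * 0 ^ S (S k))
                 (fun _ => RtoC 0)).
      { rewrite sum_n_C0; cbn [lid_coef]; ring. }
      intro k; generalize (lid_coef n a (S (S k))); intro c; cring.
    * rewrite (sum_n_ext (fun k => lid_coef n a (S (S k)) * 1 ^ S (S k))
                 (fun k => a k / (INR (S k) * INR (S (S k))))).
      { cbn [lid_coef]; ring. }
      intro k; rewrite Cpow_1_l; exact (Cmult_1_r _).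
  + replace (Nat.eqb (2 * S m) (2 * S j)) with (Nat.eqb (2 * m) (2 * j)).
    2:{ apply Bool.eq_true_iff_eq; rewrite !Nat.eqb_eq; lia. }
    replace (2 * S j)%nat with (S (S (2 * j))) by lia.
    rewrite !C_derive_n_S, !C_derive_poly_fun.
    replace (poly_fun (deriv_coef (deriv_coef (lid_coef n a))) n) with P.
    { apply DP; now exists j. }
    apply functional_extensionality; intro z; rewrite HP.
    unfold poly_fun; apply sum_n_ext; intro k; f_equal.
    unfold deriv_coef, lid_coef.
    field; split; apply INR_S_neq0.
Qed.

Theorem Lidstone0_exists_unique (t : nat) :
  Nat.Even t -> exists! P : C -> C, is_Lidstone0 t P.
Proof.
intros [m ->]; destruct (is_Lidstone0_exists m) as [P HP].
exists P; split; [exact HP | intros Q; now apply is_Lidstone0_unique].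
Qed.

Lemma Lidstone0_spec (t : nat) : Nat.Even t -> is_Lidstone0 t (Lidstone0 t).
Proof.
intros [m ->]; unfold Lidstone0; apply epsilon_spec, is_Lidstone0_exists.
Qed.

(* Main.v *)
Require Import Defs.
From Stdlib Require Import Reals ZArith Arith Factorial Lra Lia FunctionalExtensionality.
From Coquelicot Require Import Coquelicot.

Open Scope C_scope.

(** Both sides satisfy the same differential recursion, so it is enough to
    compare them once, where the claim is a residue computation with simple
    poles only.

    Put $w_m(\zeta)=\zeta\,\zeta^{-2m}$, so that $m=t/2+1$ gives
    $\zeta^{-t-1}$.  The poles of $\coth$ inside the circle are
    $p_j=\mathrm{i}(j-K)\pi$ for $0\le j\le 2K$, all simple with residue 1, and
    pairing $p_{K+k}$ with $p_{K-k}$ turns $\sum_j w_m(p_j)\sinh(p_jz)$, with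
    0 for the term $p_K=0$, into the sine sum of the theorem
    ([residue_part_sin]).  Let [defect] K m z be
    $$\Lambda_{t,0}(z)-\frac{z^t}{t!}-\sum_j w_m(p_j)\sinh(p_jz)
      +\frac1{2\pi\mathrm{i}}\int w_m(\zeta)\sinh(\zeta z)\coth\zeta\,d\zeta,$$
    without the first two terms when $m=0$.  Two derivatives in $z$ multiply
    $w_m(\zeta)\sinh(\zeta z)$ by $\zeta^2$ and lower $t$ by 2 in the other
    terms, so the second derivative of the $(m+1)$-st defect is the $m$-th one.
    At $z=0$ the terms cancel.  At $z=1$ the integrand becomes
    $\zeta^{-t-1}\cosh\zeta$, whose integral is $2\pi\mathrm{i}/t!$
    ([circle_int_cosh_moment]), and everything cancels again.  Hence the defect
    vanishes for all $m$ ([defect_zero]) as soon as it vanishes for $m=0$.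

    For $m=0$ the integrand has no other poles than the simple ones of $\coth$, and
    the claim is the residue formula for $h\coth$ with $h$ entire
    ([circle_int_coth]).  The several poles are separated by iterating
    $$\coth w=\tfrac12\bigl(\coth\tfrac w2
      +\coth(\tfrac w2-\tfrac{\mathrm{i}\pi}2)\bigr),$$
    which writes $\coth$ as an average of $2^n$ functions
    $\coth((\zeta-p_j)/2^n)$ with poles $2^n\pi$ apart.  Once $2^n>2K$ each of
    them has at most one pole in the disc.

    One simple pole, or none, is handled by deforming the contour linearly
    ([line_homotopy]): the circle is contracted to the pole, where the integral
    tends to $2\pi\mathrm{i}$ times the residue
    ([circle_int_simple_pole]). *)

(** * Complex-valued functions of a real variable *)

Definition cderive (f : R -> C) (x : R) (l : C) : Prop :=
  is_derive (K := R_AbsRing) (V := C_R_NormedModule) f x l.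

(** Continuity is wanted on three domains: real parameters, pairs of real
    parameters (for differentiation under the integral sign) and C. *)
Definition Ccont {T : UniformSpace} (f : T -> C) (x : T) : Prop :=
  continuous (U := C_UniformSpace) f x.

Definition CInt (f : R -> C) (a b : R) : C :=
  RInt (V := C_R_CompleteNormedModule) f a b.

(** Exposes the type C where it is displayed as the carrier of an algebraic
    structure, so that [ring] and [field] recognize it. *)
Ltac toC := match goal with |- @eq _ ?a ?b => change (@eq C a b); simpl end.

Lemma cderive_pair (f : R -> C) (x : R) (l : C) :
  cderive f x l <->
  is_derive (fun t => fst (f t)) x (fst l) /\
  is_derive (fun t => snd (f t)) x (snd l).
Proof.
split.
- intro H; split.
  + eapply filterdiff_ext_lin.
    * exact (filterdiff_comp' f (fun z : C => fst z) x _ _ H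
        (filterdiff_linear _ (is_linear_fst (K := R_AbsRing)))).
    * intro y; reflexivity.
  + eapply filterdiff_ext_lin.
    * exact (filterdiff_comp' f (fun z : C => snd z) x _ _ H
        (filterdiff_linear _ (is_linear_snd (K := R_AbsRing)))).
    * intro y; reflexivity.
- intros [H1 H2].
  apply (is_derive_ext (fun t => (fst (f t), snd (f t)))).
  { intro t; symmetry; apply surjective_pairing. }
  assert (P : forall F : (R * R -> Prop) -> Prop, Filter F ->
    filterdiff (K := R_AbsRing) (U := C_R_NormedModule) (V := C_R_NormedModule)
      (fun u => (fst u, snd u)) F (fun u => (fst u, snd u))).
  { intros F HF.
    apply (filterdiff_ext (fun u => u)); [apply surjective_pairing |].
    apply (filterdiff_ext_lin (fun u => u) (fun u => u));
      [apply filterdiff_id | apply surjective_pairing]. }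
  exact (filterdiff_comp'_2 (fun t => fst (f t)) (fun t => snd (f t))
      (fun a b => (a, b) : C_R_NormedModule) x _ _
      (fun a b => (a, b) : C_R_NormedModule) H1 H2 (P _ _)).
Qed.

Lemma Ccont_pair {T : UniformSpace} (f : T -> C) (x : T) :
  Ccont f x <->
  continuous (fun t => fst (f t)) x /\ continuous (fun t => snd (f t)) x.
Proof.
split.
- intro H; split; eapply (continuous_comp f);
    [exact H | destruct (f x); apply continuous_fst
    | exact H | destruct (f x); apply continuous_snd].
- intros [H1 H2]. intros P [e He].
  assert (A := H1 _ (locally_ball (fst (f x)) e)).
  assert (B := H2 _ (locally_ball (snd (f x)) e)).
  unfold filtermap in *.
  eapply filter_imp ; [| exact (filter_and _ _ A B)].
  intros y [Y1 Y2]; apply He; split; assumption.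
Qed.

Lemma cderive_const (c : C) (x : R) : cderive (fun _ => c) x 0.
Proof. exact (is_derive_const (V := C_R_NormedModule) c x). Qed.

Lemma cderive_plus (f g : R -> C) (x : R) (a b : C) :
  cderive f x a -> cderive g x b -> cderive (fun t => f t + g t) x (a + b).
Proof. exact (is_derive_plus (V := C_R_NormedModule) f g x a b). Qed.

Lemma cderive_mult (f g : R -> C) (x : R) (a b : C) :
  cderive f x a -> cderive g x b ->
  cderive (fun t => f t * g t) x (a * g x + f x * b).
Proof.
intros [F1 F2]%cderive_pair [G1 G2]%cderive_pair; apply cderive_pair; simpl.
split; evar_last.
- apply (is_derive_minus (V := R_NormedModule));
    apply (is_derive_mult (K := R_AbsRing)); eauto; intros; apply Rmult_comm.
- cbn; ring.
- apply (is_derive_plus (V := R_NormedModule));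
    apply (is_derive_mult (K := R_AbsRing)); eauto; intros; apply Rmult_comm.
- cbn; ring.
Qed.

Lemma Cnorm2_neq0 (z : C) : z <> 0 -> (fst z * fst z + snd z * snd z)%R <> 0%R.
Proof.
intros H E; apply H; destruct z as [x y]; simpl in E.
apply injective_projections; simpl; nra.
Qed.

(** The quotient rule for the two components $u/(u^2+v^2)$ and
    $-v/(u^2+v^2)$. *)
Lemma cderive_inv (f : R -> C) (x : R) (a : C) :
  cderive f x a -> f x <> 0 ->
  cderive (fun t => / f t) x (- a / (f x * f x)).
Proof.
intros [F1 F2]%cderive_pair N%Cnorm2_neq0; apply cderive_pair.
assert (D1 := is_derive_unique _ _ _ F1). assert (D2 := is_derive_unique _ _ _ F2).
cbn in *.
revert F1 F2 N D1 D2.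
set (u := fun t => fst (f t)); set (v := fun t => snd (f t)).
change (fst (f x)) with (u x); change (snd (f x)) with (v x).
intros F1 F2 N D1 D2.
split.
- apply (is_derive_ext (fun t => u t / (u t ^ 2 + v t ^ 2))%R); [reflexivity |].
  auto_derive; [repeat split; try (eexists; eassumption); contradict N; lra |].
  change (Derive (fun y => u y) x) with (Derive u x);
    change (Derive (fun y => v y) x) with (Derive v x).
  rewrite D1, D2; cbn; field; split; intro E; apply N; [| lra].
  apply Rsqr_0_uniq; rewrite <- E; unfold Rsqr; ring.
- apply (is_derive_ext (fun t => - v t / (u t ^ 2 + v t ^ 2))%R); [reflexivity |].
  auto_derive; [repeat split; try (eexists; eassumption); contradict N; lra |].
  change (Derive (fun y => u y) x) with (Derive u x);
    change (Derive (fun y => v y) x) with (Derive v x).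
  rewrite D1, D2; cbn; field; split; intro E; apply N; [| lra].
  apply Rsqr_0_uniq; rewrite <- E; unfold Rsqr; ring.
Qed.

Lemma cderive_exp (f : R -> C) (x : R) (a : C) :
  cderive f x a -> cderive (fun t => Cexp (f t)) x (Cexp (f x) * a).
Proof.
intros [F1 F2]%cderive_pair; apply cderive_pair.
assert (D1 := is_derive_unique _ _ _ F1). assert (D2 := is_derive_unique _ _ _ F2).
unfold Cexp, Re, Im; cbn in *.
revert F1 F2 D1 D2.
set (u := fun t => fst (f t)); set (v := fun t => snd (f t)).
change (fst (f x)) with (u x); change (snd (f x)) with (v x).
intros F1 F2 D1 D2.
split.
- apply (is_derive_ext (fun t => exp (u t) * cos (v t))%R); [reflexivity |].
  auto_derive; [repeat split; eexists; eassumption |].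
  change (Derive (fun y => u y) x) with (Derive u x);
    change (Derive (fun y => v y) x) with (Derive v x).
  rewrite D1, D2; ring.
- apply (is_derive_ext (fun t => exp (u t) * sin (v t))%R); [reflexivity |].
  auto_derive; [repeat split; eexists; eassumption |].
  change (Derive (fun y => u y) x) with (Derive u x);
    change (Derive (fun y => v y) x) with (Derive v x).
  rewrite D1, D2; ring.
Qed.

Section Continuity.
Context {T : UniformSpace}.
Implicit Types f g : T -> C.

Lemma Ccont_const (c : C) (x : T) : Ccont (fun _ : T => c) x.
Proof. apply continuous_const. Qed.

Lemma Ccont_plus f g x : Ccont f x -> Ccont g x -> Ccont (fun t => f t + g t) x.
Proof. exact (continuous_plus (V := C_R_NormedModule) f g x). Qed.

Lemma Ccont_mult f g x : Ccont f x -> Ccont g x -> Ccont (fun t => f t * g t) x.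
Proof.
intros [F1 F2]%Ccont_pair [G1 G2]%Ccont_pair; apply Ccont_pair; split.
- apply (continuous_minus (V := R_NormedModule));
    apply (continuous_mult (K := R_AbsRing)); assumption.
- apply (continuous_plus (V := R_NormedModule));
    apply (continuous_mult (K := R_AbsRing)); assumption.
Qed.

Lemma Ccont_inv f x : Ccont f x -> f x <> 0 -> Ccont (fun t => / f t) x.
Proof.
intros [F1 F2]%Ccont_pair N%Cnorm2_neq0.
assert (D : continuous
  (fun t => / (fst (f t) * fst (f t) + snd (f t) * snd (f t)))%R x).
{ apply (continuous_comp (fun t => (fst (f t) * fst (f t) + snd (f t) * snd (f t))%R) Rinv);
    [| apply continuous_Rinv; exact N].
  apply (continuous_plus (V := R_NormedModule));
    apply (continuous_mult (K := R_AbsRing)); assumption. }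
apply (continuous_ext
  (fun t => (fst (f t) * / (fst (f t) * fst (f t) + snd (f t) * snd (f t)),
             - snd (f t) * / (fst (f t) * fst (f t) + snd (f t) * snd (f t)))%R)).
{ intro t; unfold Cinv, Rdiv; apply injective_projections; simpl;
    now rewrite !Rmult_1_r. }
apply Ccont_pair; split.
- apply (continuous_mult (K := R_AbsRing)); assumption.
- apply (continuous_mult (K := R_AbsRing)); [| assumption].
  apply (continuous_opp (V := R_NormedModule)); assumption.
Qed.

Lemma Ccont_exp f x : Ccont f x -> Ccont (fun t => Cexp (f t)) x.
Proof.
intros [F1 F2]%Ccont_pair; apply Ccont_pair; split;
  apply (continuous_mult (K := R_AbsRing)).
1, 3: eapply continuous_comp; [exact F1 | apply continuous_exp].
- eapply continuous_comp; [exact F2 | apply continuous_cos].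
- eapply continuous_comp; [exact F2 | apply continuous_sin].
Qed.

Lemma Ccont_RtoC (r : T -> R) x : continuous r x -> Ccont (fun t => RtoC (r t)) x.
Proof.
intro H; apply Ccont_pair; split; [exact H | apply continuous_const].
Qed.

Lemma Ccont_ext f g x : (forall t, f t = g t) -> Ccont f x -> Ccont g x.
Proof. exact (continuous_ext f g x). Qed.

End Continuity.

(** * Holomorphy tested along curves *)

(** [f'] is the complex derivative of [f], tested on every differentiable real
    curve through [z].  The rules of differentiation then follow from those for
    functions of one real variable, and the chain rule is part of the
    definition.  Continuity of [f'] is included because contours are deformed
    by differentiating under the integral sign. *)
Definition holo (f f' : C -> C) (z : C) : Prop :=
  Ccont f z /\ Ccont f' z /\
  forall (g : R -> C) (x : R) (d : C), g x = z -> cderive g x d ->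
    cderive (fun t => f (g t)) x (f' z * d).

Lemma cderive_eq (f : R -> C) (x : R) (a b : C) :
  cderive f x a -> a = b -> cderive f x b.
Proof. now intros H <-. Qed.

Lemma cderive_ext (f g : R -> C) (x : R) (a : C) :
  (forall t, f t = g t) -> cderive f x a -> cderive g x a.
Proof. exact (is_derive_ext (V := C_R_NormedModule) f g x a). Qed.

Lemma holo_eq (f f' g' : C -> C) (z : C) :
  holo f f' z -> (forall w, f' w = g' w) -> holo f g' z.
Proof. intros H E; apply functional_extensionality in E; now rewrite <- E. Qed.

Lemma holo_ext (f g f' : C -> C) (z : C) :
  (forall w, f w = g w) -> holo f f' z -> holo g f' z.
Proof. intros E H; apply functional_extensionality in E; now rewrite <- E. Qed.

Lemma holo_const (c z : C) : holo (fun _ => c) (fun _ => 0) z.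
Proof.
split; [| split]; try apply Ccont_const.
intros g x d _ _; apply (cderive_eq _ _ _ _ (cderive_const c x)); ring.
Qed.

Lemma holo_id (z : C) : holo (fun w => w) (fun _ => 1) z.
Proof.
split; [apply continuous_id | split; [apply Ccont_const |]].
intros g x d _ H; apply (cderive_eq _ _ _ _ H); ring.
Qed.

Lemma holo_plus (f f' g g' : C -> C) (z : C) :
  holo f f' z -> holo g g' z ->
  holo (fun w => f w + g w) (fun w => f' w + g' w) z.
Proof.
intros (F1 & F2 & F3) (G1 & G2 & G3); split; [| split].
- now apply Ccont_plus.
- now apply Ccont_plus.
- intros k x d E H.
  apply (cderive_eq _ _ _ _ (cderive_plus _ _ _ _ _ (F3 k x d E H) (G3 k x d E H))).
  ring.
Qed.

Lemma holo_mult (f f' g g' : C -> C) (z : C) :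
  holo f f' z -> holo g g' z ->
  holo (fun w => f w * g w) (fun w => f' w * g w + f w * g' w) z.
Proof.
intros (F1 & F2 & F3) (G1 & G2 & G3); split; [| split].
- now apply Ccont_mult.
- apply Ccont_plus; now apply Ccont_mult.
- intros k x d E H.
  apply (cderive_eq _ _ _ _ (cderive_mult _ _ _ _ _ (F3 k x d E H) (G3 k x d E H))).
  rewrite E; ring.
Qed.

Lemma holo_inv (f f' : C -> C) (z : C) :
  holo f f' z -> f z <> 0 ->
  holo (fun w => / f w) (fun w => - f' w / (f w * f w)) z.
Proof.
intros (F1 & F2 & F3) N; split; [| split].
- now apply Ccont_inv.
- apply Ccont_mult.
  + apply (Ccont_ext (fun w => (- (1)) * f' w)); [intro; ring |].
    apply Ccont_mult; [apply Ccont_const | exact F2].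
  + apply (Ccont_inv (fun w => f w * f w)); [now apply Ccont_mult | now apply Cmult_neq_0].
- intros k x d E H.
  refine (cderive_eq _ _ _ _ (cderive_inv _ _ _ (F3 k x d E H) _) _);
    rewrite E; [exact N | field; exact N].
Qed.

Lemma holo_exp (f f' : C -> C) (z : C) :
  holo f f' z -> holo (fun w => Cexp (f w)) (fun w => Cexp (f w) * f' w) z.
Proof.
intros (F1 & F2 & F3); split; [| split].
- now apply Ccont_exp.
- apply Ccont_mult; [now apply Ccont_exp | exact F2].
- intros k x d E H.
  apply (cderive_eq _ _ _ _ (cderive_exp _ _ _ (F3 k x d E H))).
  rewrite E; ring.
Qed.

Lemma cderive_Ccont (f : R -> C) (x : R) (l : C) : cderive f x l -> Ccont f x.
Proof.
intro H; apply (ex_derive_continuous (V := C_R_NormedModule)); now exists l.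
Qed.

Lemma cderive_RtoC (r : R -> R) (x d : R) :
  is_derive r x d -> cderive (fun t => RtoC (r t)) x d.
Proof.
intro H; apply cderive_pair; split;
  [exact H | exact (is_derive_const (V := R_NormedModule) 0%R x)].
Qed.

Lemma ex_CInt (f : R -> C) (a b : R) :
  (forall t, Ccont f t) -> ex_RInt (V := C_R_NormedModule) f a b.
Proof.
intro H; apply (ex_RInt_continuous (V := C_R_CompleteNormedModule)).
intros t _; apply H.
Qed.

Lemma is_CInt (f : R -> C) (a b : R) :
  (forall t, Ccont f t) -> is_RInt (V := C_R_NormedModule) f a b (CInt f a b).
Proof.
intro H; apply (RInt_correct (V := C_R_CompleteNormedModule)), ex_CInt, H.
Qed.

Lemma CInt_unique (f : R -> C) (a b : R) (l : C) :
  is_RInt (V := C_R_NormedModule) f a b l -> CInt f a b = l.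
Proof. apply (is_RInt_unique (V := C_R_CompleteNormedModule)). Qed.

Lemma CInt_ext (f g : R -> C) (a b : R) :
  (forall t, f t = g t) -> CInt f a b = CInt g a b.
Proof. intro E; f_equal; now apply functional_extensionality. Qed.

Lemma CInt_plus (f g : R -> C) (a b : R) :
  (forall t, Ccont f t) -> (forall t, Ccont g t) ->
  CInt (fun t => f t + g t) a b = CInt f a b + CInt g a b.
Proof.
intros F G; apply CInt_unique.
exact (is_RInt_plus (V := C_R_NormedModule) f g a b _ _ (is_CInt f a b F) (is_CInt g a b G)).
Qed.

Lemma CInt_const (c : C) (a b : R) : CInt (fun _ => c) a b = (b - a)%R * c.
Proof.
apply CInt_unique.
replace ((b - a)%R * c) with (scal (V := C_R_NormedModule) (b - a)%R c).
- apply (is_RInt_const (V := C_R_NormedModule)).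
- destruct c as [x y]; apply injective_projections; cbn; ring.
Qed.

(** The scalar is complex while the integral is linear over R, hence the
    passage through components. *)
Lemma CInt_scal (c : C) (f : R -> C) (a b : R) :
  (forall t, Ccont f t) -> CInt (fun t => c * f t) a b = c * CInt f a b.
Proof.
intro F; apply CInt_unique.
assert (I := is_CInt f a b F).
assert (I1 := is_RInt_fct_extend_fst f a b _ I).
assert (I2 := is_RInt_fct_extend_snd f a b _ I).
apply (is_RInt_fct_extend_pair (U := R_NormedModule) (V := R_NormedModule)).
- exact (is_RInt_minus (V := R_NormedModule) _ _ a b _ _
   (is_RInt_scal (V := R_NormedModule) _ a b (fst c) _ I1)
   (is_RInt_scal (V := R_NormedModule) _ a b (snd c) _ I2)).
- exact (is_RInt_plus (V := R_NormedModule) _ _ a b _ _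
   (is_RInt_scal (V := R_NormedModule) _ a b (fst c) _ I2)
   (is_RInt_scal (V := R_NormedModule) _ a b (snd c) _ I1)).
Qed.

Lemma CInt_derive (f df : R -> C) (a b : R) :
  (forall t, cderive f t (df t)) -> (forall t, Ccont df t) ->
  CInt df a b = f b - f a.
Proof.
intros D F; apply CInt_unique.
apply (is_RInt_derive (V := C_R_CompleteNormedModule)); intros t _; [apply D | apply F].
Qed.

Lemma CInt_bound (f : R -> C) (a b M : R) :
  (a <= b)%R -> (forall t, Ccont f t) ->
  (forall t, (a <= t <= b)%R -> (Cmod (f t) <= M)%R) ->
  (Cmod (CInt f a b) <= (b - a) * M)%R.
Proof.
intros ab F H; rewrite Cmod_norm.
apply (norm_RInt_le_const (V := C_R_NormedModule) f a b _ M ab).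
- intros t Ht; apply Rle_trans with (Cmod (f t)); [| now apply H].
  right; symmetry; apply (Cmod_norm (f t)).
- now apply is_CInt.
Qed.

Lemma cderive_zero (f : R -> C) (a b : R) :
  (forall t, cderive f t 0) -> f a = f b.
Proof.
intro H; assert (E := CInt_derive f (fun _ => 0) a b H (fun t => Ccont_const 0 t)).
rewrite CInt_const in E.
replace (f b) with (f b - f a + f a) by ring; rewrite <- E; ring.
Qed.

(** Differentiation under the integral sign, from the real statement applied to
    both components. *)
Lemma cderive_CInt_param (F dF : R -> R -> C) (a b : R) :
  (forall s t, cderive (fun s => F s t) s (dF s t)) ->
  (forall s t, Ccont (fun p : R * R => dF (fst p) (snd p)) (s, t)) ->
  (forall s t, Ccont (F s) t) ->
  forall s, cderive (fun s => CInt (F s) a b) s (CInt (dF s) a b).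
Proof.
intros D Cd CF s.
assert (CdF : forall s t, Ccont (dF s) t).
{ intros s' t.
  apply (continuous_comp (fun t => (s', t) : R * R) (fun p => dF (fst p) (snd p)));
    [| apply Cd].
  intros P [e He]; exists e; intros y Hy; apply He.
  split; [apply ball_center | exact Hy]. }
assert (split_int : forall G : R -> C, (forall t, Ccont G t) ->
  CInt G a b = (RInt (fun t => fst (G t)) a b, RInt (fun t => snd (G t)) a b)).
{ intros G HG; assert (I := is_CInt G a b HG).
  apply injective_projections; symmetry; apply is_RInt_unique.
  - exact (is_RInt_fct_extend_fst G a b _ I).
  - exact (is_RInt_fct_extend_snd G a b _ I). }
apply (cderive_ext (fun s =>
  (RInt (fun t => fst (F s t)) a b, RInt (fun t => snd (F s t)) a b))).
{ intro s'; symmetry; apply split_int, CF. }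
rewrite split_int by apply CdF.
assert (real : forall (f df : R -> R -> R),
  (forall s t, is_derive (fun s => f s t) s (df s t)) ->
  (forall s t, continuous (fun p : R * R => df (fst p) (snd p)) (s, t)) ->
  (forall s t, continuous (f s) t) ->
  is_derive (fun s => RInt (f s) a b) s (RInt (df s) a b)).
{ intros f df Df Cdf Cf.
  assert (E : forall u v, Derive (fun z => f z v) u = df u v).
  { intros u v; apply is_derive_unique, Df. }
  rewrite (RInt_ext (df s) (fun t => Derive (fun u => f u t) s)) by (intros; now rewrite E).
  apply (is_derive_RInt_param f a b s).
  - apply filter_forall; intros x t _; eexists; apply Df.
  - intros t _; apply continuity_2d_pt_filterlim.
    rewrite E; apply (filterlim_ext (fun p : R * R => df (fst p) (snd p)));
      [now intro p; rewrite E | apply Cdf].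
  - apply filter_forall; intros x; apply (ex_RInt_continuous (V := R_CompleteNormedModule)).
    intros t _; apply Cf. }
apply cderive_pair; split.
- apply (real (fun s t => fst (F s t)) (fun s t => fst (dF s t))).
  + intros s' t; apply (proj1 (cderive_pair _ _ _) (D s' t)).
  + intros s' t; apply (proj1 (Ccont_pair _ _) (Cd s' t)).
  + intros s' t; apply (proj1 (Ccont_pair _ _) (CF s' t)).
- apply (real (fun s t => snd (F s t)) (fun s t => snd (dF s t))).
  + intros s' t; apply (proj1 (cderive_pair _ _ _) (D s' t)).
  + intros s' t; apply (proj1 (Ccont_pair _ _) (Cd s' t)).
  + intros s' t; apply (proj1 (Ccont_pair _ _) (CF s' t)).
Qed.

(** * Linear deformation of contours *)

Lemma Ccont_comp {T : UniformSpace} (g : T -> C) (f : C -> C) (x : T) :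
  Ccont g x -> Ccont f (g x) -> Ccont (fun t => f (g t)) x.
Proof. exact (continuous_comp g f x). Qed.

Lemma Ccont_real_comp {T : UniformSpace} (r : T -> R) (f : R -> C) (x : T) :
  continuous r x -> Ccont f (r x) -> Ccont (fun t => f (r t)) x.
Proof. exact (continuous_comp r f x). Qed.

Lemma Ccont_opp {T : UniformSpace} (f : T -> C) (x : T) :
  Ccont f x -> Ccont (fun t => - f t) x.
Proof. exact (continuous_opp (V := C_R_NormedModule) f x). Qed.

Lemma Ccont_minus {T : UniformSpace} (f g : T -> C) (x : T) :
  Ccont f x -> Ccont g x -> Ccont (fun t => f t - g t) x.
Proof. intros F G; apply Ccont_plus; [exact F | now apply Ccont_opp]. Qed.

Definition circ (r : R) (t : R) : C := r * Cexp (Ci * t).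

Lemma circ_cderive (r t : R) : cderive (circ r) t (Ci * circ r t).
Proof.
refine (cderive_eq _ _ _ _ (cderive_mult _ _ _ _ _ (cderive_const r t)
  (cderive_exp _ _ _ (cderive_mult _ _ _ _ _ (cderive_const Ci t)
    (cderive_RtoC (fun t => t) t 1 (is_derive_id (K := R_AbsRing) t))))) _).
unfold circ; ring.
Qed.

Lemma circ_Ccont (r t : R) : Ccont (circ r) t.
Proof. exact (cderive_Ccont _ _ _ (circ_cderive r t)). Qed.

(** The patterns are syntactic because unification up to conversion, which unfolds
    the arithmetic of C, need not terminate on these goals. *)
Ltac ccont := repeat match goal with
  | |- Ccont (fun _ => ?a) ?y => apply (Ccont_const a y)
  | |- Ccont (fun x => @?f x + @?g x) ?y => apply (Ccont_plus f g y)
  | |- Ccont (fun x => @?f x - @?g x) ?y => apply (Ccont_minus f g y)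
  | |- Ccont (fun x => @?f x * @?g x) ?y => apply (Ccont_mult f g y)
  | |- Ccont (fun x => - @?f x) ?y => apply (Ccont_opp f y)
  | |- Ccont (circ ?r) ?t => apply (circ_Ccont r t)
  | |- Ccont (fun x => circ ?r x) ?t => apply (circ_Ccont r t)
  | H : forall t, Ccont ?f t |- Ccont ?f ?t => apply (H t)
  | H : forall t, Ccont ?f t |- Ccont (fun x => ?f x) ?t => apply (H t)
  | H : Ccont ?f ?t |- Ccont ?f ?t => exact H
  end.

(** Let $\Gamma(s,t)=p(t)+s\,q(t)$.  By equality of mixed derivatives,
    $\partial_s[f(\Gamma)\,\partial_t\Gamma]=\partial_t[f(\Gamma)\,\partial_s\Gamma]$,
    and the right-hand side integrates to zero over a closed curve, so the
    integral is constant in $s$. *)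
Lemma line_homotopy (f f' : C -> C) (p p' q q' : R -> C) (a b : R) :
  (forall t, cderive p t (p' t)) -> (forall t, Ccont p' t) ->
  (forall t, cderive q t (q' t)) -> (forall t, Ccont q' t) ->
  p a = p b -> q a = q b ->
  (forall s t : R, (0 <= s <= 1)%R -> holo f f' (p t + s * q t)) ->
  CInt (fun t => f (p t) * p' t) a b =
  CInt (fun t => f (p t + q t) * (p' t + q' t)) a b.
Proof.
intros Dp Cp' Dq Cq' Ep Eq H.
(* A smooth map of R onto [0, 1], equal to 0 at 0 and to 1 at PI: as a function of
   [u] the deformation is defined on all of R and never leaves the region where
   [f] is holomorphic. *)
set (sg := fun u : R => ((1 - cos u) / 2)%R).
assert (Hsg : forall u, (0 <= sg u <= 1)%R).
{ intro u; unfold sg; generalize (COS_bound u); lra. }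
assert (Dsg : forall u, cderive (fun u => RtoC (sg u)) u (sin u / 2)%R).
{ intro u; apply cderive_RtoC; unfold sg; auto_derive; [trivial | field]. }
assert (Csg : forall u, continuous sg u).
{ intro u; apply (ex_derive_continuous sg); unfold sg; auto_derive; trivial. }
assert (Cp : forall t, Ccont p t) by (intro t; exact (cderive_Ccont _ _ _ (Dp t))).
assert (Cq : forall t, Ccont q t) by (intro t; exact (cderive_Ccont _ _ _ (Dq t))).
set (G := fun u t => p t + sg u * q t).
assert (HG : forall u t, holo f f' (G u t)) by (intros; apply H, Hsg).
set (F := fun u t => f (G u t) * (p' t + sg u * q' t)).
set (dF := fun u t => (sin u / 2)%R *
  (f' (G u t) * q t * (p' t + sg u * q' t) + f (G u t) * q' t)).
(* Here is closedness of the curves used: for fixed u, dF u is the derivative in t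
   of sg'(u) * f (G u t) * q t, which takes equal values at a and b. *)
assert (dF0 : forall u, CInt (dF u) a b = 0).
{ intro u.
  rewrite (CInt_derive (fun t => (sin u / 2)%R * (f (G u t) * q t))).
  - unfold G; rewrite Ep, Eq; ring.
  - intro t; unfold dF.
    destruct (HG u t) as (_ & _ & D).
    refine (cderive_eq _ _ _ _ (cderive_mult _ _ _ _ _ (cderive_const _ t)
      (cderive_mult _ _ _ _ _ (D (G u) t (p' t + sg u * q' t) eq_refl _) (Dq t))) _).
    + refine (cderive_eq _ _ _ _ (cderive_plus _ _ _ _ _ (Dp t)
        (cderive_mult _ _ _ _ _ (cderive_const _ t) (Dq t))) _); ring.
    + ring.
  - intro t; destruct (HG u t) as (C1 & C2 & _); unfold dF.
    assert (CG : Ccont (G u) t).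
    { unfold G; ccont; auto. }
    ccont; auto;
      apply (Ccont_comp (G u)); auto. }
assert (E : CInt (F 0%R) a b = CInt (F PI) a b).
{ apply (cderive_zero (fun u => CInt (F u) a b)); intro u; rewrite <- (dF0 u).
  apply cderive_CInt_param.
  - clear u; intros u t; unfold F, dF.
    destruct (HG u t) as (_ & _ & D).
    refine (cderive_eq _ _ _ _ (cderive_mult _ _ _ _ _
      (D (fun u => G u t) u ((sin u / 2)%R * q t) eq_refl _)
      (cderive_plus _ _ _ _ _ (cderive_const _ u)
         (cderive_mult _ _ _ _ _ (Dsg u) (cderive_const _ u)))) _).
    + refine (cderive_eq _ _ _ _ (cderive_plus _ _ _ _ _ (cderive_const _ u)
         (cderive_mult _ _ _ _ _ (Dsg u) (cderive_const _ u))) _); ring.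
    + simpl; ring.
  - clear u; intros u t; unfold dF.
    destruct (HG u t) as (C1 & C2 & _).
    assert (Kfst : continuous (fun p : R * R => fst p) (u, t)) by apply continuous_fst.
    assert (Ksnd : continuous (fun p : R * R => snd p) (u, t)) by apply continuous_snd.
    assert (Ks : Ccont (fun p : R * R => RtoC (sg (fst p))) (u, t)).
    { apply Ccont_RtoC, (continuous_comp fst sg); [exact Kfst | apply Csg]. }
    assert (Kr : forall r : R -> C, (forall t, Ccont r t) ->
       Ccont (fun p : R * R => r (snd p)) (u, t)).
    { intros r Hr; apply (Ccont_real_comp snd r); auto. }
    assert (KG : Ccont (fun p : R * R => G (fst p) (snd p)) (u, t)).
    { unfold G; ccont; auto. }
    apply Ccont_mult.
    { apply Ccont_RtoC, (continuous_comp fst (fun u => (sin u / 2)%R)); [exact Kfst |].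
      apply (ex_derive_continuous (fun u => (sin u / 2)%R)); auto_derive; trivial. }
    ccont; auto;
      apply (Ccont_comp (fun p : R * R => G (fst p) (snd p))); auto.
  - clear u; intros u t; unfold F; destruct (HG u t) as (C1 & _).
    apply Ccont_mult.
    + apply (Ccont_comp (G u)); [| exact C1].
      unfold G; ccont; auto.
    + ccont; auto. }
unfold F, G in E.
rewrite (CInt_ext (fun t => f (p t) * p' t)
  (fun t => f (p t + sg 0%R * q t) * (p' t + sg 0%R * q' t))), E.
- apply CInt_ext; intro t.
  replace (sg PI) with 1%R by (unfold sg; rewrite cos_PI; field).
  f_equal; [f_equal |]; ring.
- intro t; replace (sg 0%R) with 0%R by (unfold sg; rewrite cos_0; field).
  f_equal; [f_equal |]; ring.
Qed.

(** * Integrals over circles *)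

Lemma circle_int_circ (f : C -> C) (r : R) :
  circle_int f r = CInt (fun t => f (circ r t) * (Ci * circ r t)) 0 (2 * PI).
Proof. reflexivity. Qed.

Lemma Cexp_0 : Cexp 0 = 1.
Proof.
unfold Cexp; simpl; rewrite exp_0, cos_0, sin_0.
apply injective_projections; simpl; ring.
Qed.

Lemma Cexp_imag (t : R) : Cexp (Ci * t) = (cos t, sin t).
Proof.
unfold Cexp; simpl.
replace (0 * t - 1 * 0)%R with 0%R by ring.
replace (0 * 0 + 1 * t)%R with t by ring.
rewrite exp_0; apply injective_projections; simpl; ring.
Qed.

Lemma circ_closed (r : R) : circ r 0 = circ r (2 * PI).
Proof.
unfold circ; rewrite !Cexp_imag.
now rewrite cos_2PI, sin_2PI, cos_0, sin_0.
Qed.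

Lemma Cmod_circ (r t : R) : (0 <= r)%R -> Cmod (circ r t) = r.
Proof.
intro Hr; unfold circ; rewrite Cmod_mult, Cmod_R, Rabs_pos_eq by exact Hr.
rewrite Cexp_imag; unfold Cmod; simpl.
replace (cos t * (cos t * 1) + sin t * (sin t * 1))%R with 1%R.
- rewrite sqrt_1; ring.
- generalize (sin2_cos2 t); unfold Rsqr; lra.
Qed.

Lemma circ_neq_inside (r t : R) (c : C) : (Cmod c < r)%R -> circ r t - c <> 0.
Proof.
intros H E; assert (E' : circ r t = c).
{ replace c with (circ r t - (circ r t - c)) by ring; rewrite E; ring. }
assert (M := Cmod_circ r t); generalize (Cmod_ge_0 c); rewrite E' in M; lra.
Qed.

(** Translating the circle by $-c$ keeps it away from the origin, so the integral
    equals that of $1/\zeta$ over the centred circle. *)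
Lemma winding_number (r : R) (c : C) :
  (Cmod c < r)%R -> circle_int (fun z => / (z - c)) r = 2 * PI * Ci.
Proof.
intro H; rewrite circle_int_circ.
assert (H0 := Cmod_ge_0 c).
transitivity (CInt (fun _ => Ci) 0 (2 * PI)).
2:{ rewrite CInt_const, Rminus_0_r, RtoC_mult; ring. }
rewrite (CInt_ext (fun _ => Ci) (fun t => / circ r t * (Ci * circ r t))).
- symmetry.
  rewrite (line_homotopy Cinv (fun z => - (1) / (z * z)) (circ r) (fun t => Ci * circ r t)
    (fun _ => - c) (fun _ => 0)).
  + apply CInt_ext; intro t; unfold Cminus; ring.
  + apply circ_cderive.
  + intro t; ccont.
  + intro t; apply cderive_const.
  + intro t; ccont.
  + apply circ_closed.
  + reflexivity.
  + intros s t Hs; apply (holo_inv (fun z => z) (fun _ => 1)); [apply holo_id |].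
    replace (circ r t + s * - c) with (circ r t - s * c) by ring.
    apply circ_neq_inside; rewrite Cmod_mult, Cmod_R, Rabs_pos_eq by lra; nra.
- intro t; field.
  replace (circ r t) with (circ r t - 0) by ring.
  apply circ_neq_inside; rewrite Cmod_0; lra.
Qed.

(** The circle is contracted to its centre. *)
Lemma circle_int_holo (f f' : C -> C) (r : R) :
  (0 <= r)%R -> (forall z, (Cmod z <= r)%R -> holo f f' z) -> circle_int f r = 0.
Proof.
intros Hr H; rewrite circle_int_circ.
rewrite (line_homotopy f f' (circ r) (fun t => Ci * circ r t)
  (fun t => - (1) * circ r t) (fun t => - (1) * (Ci * circ r t))).
- rewrite (CInt_ext _ (fun _ => 0)) by (intro t; ring).
  rewrite CInt_const; ring.
- apply circ_cderive.
- intro t; ccont.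
- intro t; refine (cderive_eq _ _ _ _ (cderive_mult _ _ _ _ _
    (cderive_const _ t) (circ_cderive r t)) _); ring.
- intro t; ccont.
- apply circ_closed.
- f_equal; apply circ_closed.
- intros s t Hs; apply H.
  replace (circ r t + s * (- (1) * circ r t)) with ((1 - s)%R * circ r t)
    by (rewrite RtoC_minus; ring).
  rewrite Cmod_mult, Cmod_R, Rabs_pos_eq, Cmod_circ by lra; nra.
Qed.

Lemma Ccont_eps (g : C -> C) (c : C) (eps : R) :
  Ccont g c -> (0 < eps)%R ->
  exists eta : R, (0 < eta)%R /\
    forall z, (Cmod (z - c) < eta)%R -> (Cmod (g z - g c) <= eps)%R.
Proof.
intros H He.
assert (H2 : (0 < sqrt 2)%R) by (apply sqrt_lt_R0; lra).
assert (He' : (0 < eps / sqrt 2)%R) by (apply Rdiv_lt_0_compat; lra).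
destruct (H _ (locally_ball (g c) (mkposreal _ He'))) as [eta Heta].
exists eta; split; [apply cond_pos |].
intros z Hz; apply Rlt_le.
replace eps with (sqrt 2 * mkposreal _ He')%R by (simpl; field; lra).
apply (C_NormedModule_mixin_compat2 (g c) (g z)).
apply Heta; exact (C_NormedModule_mixin_compat1 c z eta Hz).
Qed.

(** The contour is contracted towards $c$ by the curves $c+\varepsilon u$ with
    $u(t)=re^{\mathrm{i}t}-c$.  There the integrand is $g(c+\varepsilon u)\,u'/u$, which
    tends uniformly to $g(c)\,u'/u$, and $\int u'/u=2\pi\mathrm{i}$ by [winding_number]. *)
Lemma circle_int_simple_pole (f f' g : C -> C) (c : C) (r : R) :
  (Cmod c < r)%R ->
  (forall z, (Cmod z <= r)%R -> z <> c -> holo f f' z) ->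
  (forall z, (Cmod z <= r)%R -> z <> c -> (z - c) * f z = g z) ->
  Ccont g c ->
  circle_int f r = 2 * PI * Ci * g c.
Proof.
intros Hc Hf Hg Cg.
assert (c0 := Cmod_ge_0 c).
set (u := fun t => circ r t - c).
assert (u0 : forall t, u t <> 0) by (intro t; now apply circ_neq_inside).
assert (Cu : forall t, Ccont u t) by (intro t; unfold u, Cminus; ccont).
assert (disc : forall s t : R, (0 < s <= 1)%R ->
  (Cmod (c + s * u t) <= r)%R /\ c + s * u t <> c).
{ intros s t Hs; split.
  - replace (c + s * u t) with ((1 - s)%R * c + s * circ r t)
      by (unfold u; rewrite RtoC_minus; ring).
    eapply Rle_trans; [apply Cmod_triangle |].
    rewrite !Cmod_mult, !Cmod_R, !Rabs_pos_eq, Cmod_circ by lra; nra.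
  - intro E; apply (Cmult_neq_0 s (u t)); [| apply u0 |].
    + intro E'; apply RtoC_inj in E'; lra.
    + replace (s * u t) with (c + s * u t - c) by ring; rewrite E; ring. }
assert (shrink : forall e : R, (0 < e <= 1)%R ->
  circle_int f r = CInt (fun t => f (c + e * u t) * (e * (Ci * circ r t))) 0 (2 * PI)).
{ intros e He; rewrite circle_int_circ.
  rewrite (line_homotopy f f' (circ r) (fun t => Ci * circ r t)
    (fun t => (1 - e)%R * (c - circ r t)) (fun t => - (1 - e)%R * (Ci * circ r t))).
  - apply CInt_ext; intro t; rewrite RtoC_minus; f_equal; [f_equal; unfold u |]; ring.
  - apply circ_cderive.
  - intro t; ccont.
  - intro t; apply (cderive_ext (fun t => (1 - e)%R * c + (- (1 - e)%R) * circ r t)).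
    { intro; ring. }
    refine (cderive_eq _ _ _ _ (cderive_plus _ _ _ _ _ (cderive_const _ t)
      (cderive_mult _ _ _ _ _ (cderive_const _ t) (circ_cderive r t))) _); ring.
  - intro t; ccont.
  - apply circ_closed.
  - f_equal; f_equal; apply circ_closed.
  - intros s t Hs.
    replace (circ r t + s * ((1 - e)%R * (c - circ r t)))
      with (c + (1 - s * (1 - e))%R * u t)
      by (unfold u; rewrite !RtoC_minus, RtoC_mult, RtoC_minus; ring).
    destruct (disc (1 - s * (1 - e))%R t) as [D1 D2]; [nra |].
    now apply Hf. }
assert (W := winding_number r c Hc); rewrite circle_int_circ in W.
set (M := (r / (r - Cmod c))%R).
assert (M0 : (0 < M)%R) by (apply Rdiv_lt_0_compat; lra).
assert (P := PI_RGT_0).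
assert (close : forall d : R, (0 < d)%R ->
  (Cmod (circle_int f r - 2 * PI * Ci * g c) <= 2 * PI * (d * M))%R).
{ intros d Hd; destruct (Ccont_eps g c d Cg Hd) as [eta [Heta Hgc]].
  (* Since |u| < 2 r, this keeps c + e u within eta of c. *)
  set (e := Rmin 1 (eta / (4 * r))).
  assert (He : (0 < e <= 1)%R).
  { split; [apply Rmin_glb_lt; [lra | apply Rdiv_lt_0_compat; lra] | apply Rmin_l]. }
  assert (He' : (e * (2 * r) < eta)%R).
  { apply Rle_lt_trans with (eta / (4 * r) * (2 * r))%R.
    - apply Rmult_le_compat_r; [lra | apply Rmin_r].
    - replace (eta / (4 * r) * (2 * r))%R with (eta / 2)%R by (field; lra); lra. }
  assert (Cf : forall t, Ccont (fun t => f (c + e * u t) * (e * (Ci * circ r t))) t).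
  { intro t; destruct (disc e t He) as [D1 D2].
    ccont; apply (Ccont_comp (fun t => c + e * u t)); [ccont; apply Cu |].
    now apply (Hf _ D1 D2). }
  assert (Cw : forall t, Ccont (fun t => (- g c) * (/ (circ r t - c) * (Ci * circ r t))) t).
  { intro t; ccont; apply (Ccont_inv u); [apply Cu | apply u0]. }
  rewrite (shrink e He), <- W.
  replace (CInt (fun t => f (c + e * u t) * (e * (Ci * circ r t))) 0 (2 * PI) -
    CInt (fun t => / (circ r t - c) * (Ci * circ r t)) 0 (2 * PI) * g c)
   with (CInt (fun t => f (c + e * u t) * (e * (Ci * circ r t)) +
    (- g c) * (/ (circ r t - c) * (Ci * circ r t))) 0 (2 * PI)).
  - replace (2 * PI * (d * M))%R with ((2 * PI - 0) * (d * M))%R by ring.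
    apply CInt_bound; [lra | intro t; now apply Ccont_plus |].
    intros t _; destruct (disc e t He) as [D1 D2].
    replace (f (c + e * u t) * (e * (Ci * circ r t)) +
      (- g c) * (/ (circ r t - c) * (Ci * circ r t)))
      with ((g (c + e * u t) - g c) * (Ci * circ r t / u t)).
    + rewrite Cmod_mult; apply Rmult_le_compat; try apply Cmod_ge_0.
      * apply Hgc; replace (c + e * u t - c) with (e * u t) by ring.
        rewrite Cmod_mult, Cmod_R, Rabs_pos_eq by lra.
        apply Rle_lt_trans with (2 := He'), Rmult_le_compat_l; [lra |].
        unfold u, Cminus; eapply Rle_trans; [apply Cmod_triangle |].
        rewrite Cmod_opp, Cmod_circ by lra; lra.
      * unfold Cdiv; rewrite !Cmod_mult, Cmod_inv, Cmod_circ by (apply u0 || lra).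
        replace (Cmod Ci) with 1%R by
          (unfold Cmod; simpl; rewrite <- sqrt_1 at 1; f_equal; ring).
        rewrite Rmult_1_l; unfold M, Rdiv; apply Rmult_le_compat_l; [lra |].
        apply Rinv_le_contravar; [lra |].
        unfold u; generalize (Cmod_triangle (circ r t - c) c).
        replace (circ r t - c + c) with (circ r t) by ring.
        rewrite Cmod_circ by lra; lra.
    + rewrite <- (Hg _ D1 D2); unfold u; field.
      apply (u0 t).
  - rewrite CInt_plus, CInt_scal by (auto; intro t; ccont; apply (Ccont_inv u); auto).
    ring. }
destruct (Req_dec (Cmod (circle_int f r - 2 * PI * Ci * g c)) 0) as [E | E].
- apply Cmod_eq_0 in E.
  replace (circle_int f r) with (circle_int f r - 2 * PI * Ci * g c + 2 * PI * Ci * g c)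
    by ring.
  rewrite E; ring.
- exfalso; set (X := Cmod (circle_int f r - 2 * PI * Ci * g c)) in *.
  assert (X0 : (0 < X)%R).
  { generalize (Cmod_ge_0 (circle_int f r - 2 * PI * Ci * g c)); fold X; lra. }
  (* With this accuracy the bound is X / 2. *)
  assert (D := close (X / (4 * PI * M))%R).
  assert (Q : (2 * PI * (X / (4 * PI * M) * M) = X / 2)%R) by (field; lra).
  rewrite Q in D.
  assert (Y : (0 < X / (4 * PI * M))%R) by (apply Rdiv_lt_0_compat; nra).
  specialize (D Y); lra.
Qed.

(** * Hyperbolic functions *)

Lemma Cexp_plus (a b : C) : Cexp (a + b) = Cexp a * Cexp b.
Proof.
unfold Cexp, Re, Im; simpl; rewrite exp_plus, cos_plus, sin_plus.
apply injective_projections; simpl; ring.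
Qed.

Lemma C2_neq0 : RtoC 2 <> 0.
Proof. intro E; apply RtoC_inj in E; lra. Qed.

Lemma Csinh_0 : Csinh 0 = 0.
Proof. unfold Csinh; replace (- 0) with (RtoC 0) by ring; field; apply C2_neq0. Qed.

Lemma Ccosh_0 : Ccosh 0 = 1.
Proof.
unfold Ccosh; replace (- 0) with (RtoC 0) by ring; rewrite Cexp_0.
field; apply C2_neq0.
Qed.

Lemma holo_Csinh (f f' : C -> C) (z : C) :
  holo f f' z -> holo (fun w => Csinh (f w)) (fun w => Ccosh (f w) * f' w) z.
Proof.
intro H; assert (H1 := holo_exp _ _ _ H).
assert (H2 := holo_exp _ _ _ (holo_mult _ _ _ _ _ (holo_const (- (1)) z) H)).
assert (H3 := holo_plus _ _ _ _ _ H1 (holo_mult _ _ _ _ _ (holo_const (- (1)) z) H2)).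
assert (H4 := holo_mult _ _ _ _ _ H3 (holo_const (/ 2) z)).
assert (E : forall w, - (1) * f w = - f w) by (intro; ring).
apply (holo_ext (fun w => (Cexp (f w) + - (1) * Cexp (- (1) * f w)) * / 2)).
{ intro w; unfold Csinh; rewrite E; field; apply C2_neq0. }
eapply holo_eq; [exact H4 |].
intro w; unfold Ccosh; rewrite !E; field; apply C2_neq0.
Qed.

Lemma holo_Ccosh (f f' : C -> C) (z : C) :
  holo f f' z -> holo (fun w => Ccosh (f w)) (fun w => Csinh (f w) * f' w) z.
Proof.
intro H; assert (H1 := holo_exp _ _ _ H).
assert (H2 := holo_exp _ _ _ (holo_mult _ _ _ _ _ (holo_const (- (1)) z) H)).
assert (H3 := holo_plus _ _ _ _ _ H1 H2).
assert (H4 := holo_mult _ _ _ _ _ H3 (holo_const (/ 2) z)).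
assert (E : forall w, - (1) * f w = - f w) by (intro; ring).
apply (holo_ext (fun w => (Cexp (f w) + Cexp (- (1) * f w)) * / 2)).
{ intro w; unfold Ccosh; rewrite E; field; apply C2_neq0. }
eapply holo_eq; [exact H4 |].
intro w; unfold Csinh; rewrite !E; field; apply C2_neq0.
Qed.

Lemma holo_Csinh_id (z : C) : holo Csinh Ccosh z.
Proof. eapply holo_eq; [apply (holo_Csinh _ _ z (holo_id z)) | intro; cbv beta; ring]. Qed.

Lemma holo_Ccosh_id (z : C) : holo Ccosh Csinh z.
Proof. eapply holo_eq; [apply (holo_Ccosh _ _ z (holo_id z)) | intro; cbv beta; ring]. Qed.

Lemma Csinh_double (w : C) : Csinh (w + w) = 2 * Csinh w * Ccosh w.
Proof.
unfold Ccosh, Csinh; replace (- (w + w)) with (- w + - w) by ring.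
rewrite !Cexp_plus; field; apply C2_neq0.
Qed.

Lemma Ccosh_double (w : C) :
  Ccosh (w + w) = Ccosh w * Ccosh w + Csinh w * Csinh w.
Proof.
unfold Ccosh, Csinh; replace (- (w + w)) with (- w + - w) by ring.
rewrite !Cexp_plus; field; apply C2_neq0.
Qed.

Lemma Cexp_Ci_PI2 : Cexp (Ci * (PI / 2)%R) = Ci.
Proof. now rewrite Cexp_imag, cos_PI2, sin_PI2. Qed.

Lemma Cexp_opp_Ci_PI2 : Cexp (- (Ci * (PI / 2)%R)) = - Ci.
Proof.
replace (- (Ci * (PI / 2)%R)) with (Ci * (- (PI / 2))%R) by (rewrite RtoC_opp; ring).
rewrite Cexp_imag, cos_neg, sin_neg, cos_PI2, sin_PI2.
apply injective_projections; simpl; ring.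
Qed.

Lemma Csinh_quarter (w : C) : Csinh (w - Ci * (PI / 2)%R) = - Ci * Ccosh w.
Proof.
unfold Ccosh, Csinh, Cminus.
replace (- (w + - (Ci * (PI / 2)%R))) with (- w + Ci * (PI / 2)%R) by ring.
rewrite !Cexp_plus, Cexp_Ci_PI2, Cexp_opp_Ci_PI2; field; apply C2_neq0.
Qed.

Lemma Ccosh_quarter (w : C) : Ccosh (w - Ci * (PI / 2)%R) = - Ci * Csinh w.
Proof.
unfold Ccosh, Csinh, Cminus.
replace (- (w + - (Ci * (PI / 2)%R))) with (- w + Ci * (PI / 2)%R) by ring.
rewrite !Cexp_plus, Cexp_Ci_PI2, Cexp_opp_Ci_PI2; field; apply C2_neq0.
Qed.

Lemma Ci2 : Ci * Ci = - (1).
Proof. apply injective_projections; simpl; ring. Qed.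

Lemma Ci_neq0 : Ci <> 0.
Proof. intro E; assert (H := f_equal snd E); simpl in H; lra. Qed.

(** The translate of $\coth$ by $-\mathrm{i}\pi/2$ is $\tanh$, and
    $\coth+\tanh$ is twice $\coth$ of the doubled argument. *)
Lemma Ccoth_double (w : C) : Csinh (w + w) <> 0 ->
  Ccoth (w + w) = (Ccoth w + Ccoth (w - Ci * (PI / 2)%R)) / 2.
Proof.
rewrite Csinh_double; intro N.
assert (Csinh w <> 0 /\ Ccosh w <> 0) as [S0 C0].
{ split; intro E; apply N; rewrite E; ring. }
unfold Ccoth; rewrite Csinh_quarter, Ccosh_quarter, Csinh_double, Ccosh_double.
field; repeat split; auto using C2_neq0, Ci_neq0.
Qed.

(** Where $\sinh$ vanishes both sides are 0, by the convention for division by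
    zero. *)
Lemma Ccoth_PI (w : C) : Ccoth (w + Ci * PI) = Ccoth w.
Proof.
set (v := w + Ci * PI).
replace w with (v - Ci * (PI / 2)%R - Ci * (PI / 2)%R).
- unfold Ccoth; repeat (rewrite Ccosh_quarter || rewrite Csinh_quarter).
  replace (- Ci * (- Ci * Ccosh v)) with (- Ccosh v).
  2:{ replace (- Ci * (- Ci * Ccosh v)) with (Ci * Ci * Ccosh v) by ring; rewrite Ci2; ring. }
  replace (- Ci * (- Ci * Csinh v)) with (- Csinh v).
  2:{ replace (- Ci * (- Ci * Csinh v)) with (Ci * Ci * Csinh v) by ring; rewrite Ci2; ring. }
  destruct (Ceq_dec (Csinh v) 0) as [E | E].
  + rewrite E; replace (- 0) with (RtoC 0) by ring.
    assert (I0 : / 0 = 0).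
    { apply injective_projections; simpl; unfold Rdiv; ring. }
    unfold Cdiv; rewrite I0; ring.
  + field; exact E.
- unfold v; rewrite RtoC_div by lra; field; apply C2_neq0.
Qed.

Lemma Ccoth_PI_nat (n : nat) (w : C) : Ccoth (w + Ci * (INR n * PI)) = Ccoth w.
Proof.
induction n as [|n IH].
- f_equal; simpl; ring.
- rewrite <- IH, <- (Ccoth_PI (w + Ci * (INR n * PI))), S_INR, RtoC_plus.
  f_equal; ring.
Qed.

(** If $e^w=e^{-w}$ with $w=x+\mathrm{i}y$, the imaginary parts give
    $\sin y=0$ and then the real parts give $e^x=e^{-x}$. *)
Lemma Csinh_zero (w : C) :
  Csinh w = 0 -> exists k : Z, w = Ci * (IZR k * PI)%R.
Proof.
destruct w as [x y]; intro E.
assert (E2 : Cexp (x, y) = Cexp (- (x, y))).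
{ replace (Cexp (x, y)) with (2 * Csinh (x, y) + Cexp (- (x, y))).
  - rewrite E; ring.
  - unfold Csinh; field; apply C2_neq0. }
unfold Cexp in E2; simpl in E2; rewrite cos_neg, sin_neg in E2.
injection E2 as E3 E4.
assert (P1 := exp_pos x); assert (P2 := exp_pos (- x)).
assert (S0 : sin y = 0%R) by nra.
assert (C0 : cos y <> 0%R).
{ intro C0; generalize (sin2_cos2 y); unfold Rsqr; rewrite S0, C0; lra. }
apply Rmult_eq_reg_r in E3; [| exact C0].
apply exp_inv in E3; assert (x0 : x = 0%R) by lra.
destruct (sin_eq_0_0 y S0) as [k ->]; exists k; rewrite x0.
apply injective_projections; simpl; ring.
Qed.

(** * Residues of quotients *)

Lemma eps_Ccont (g : C -> C) (c : C) :
  (forall eps : R, (0 < eps)%R -> exists eta : R, (0 < eta)%R /\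
    forall z, (Cmod (z - c) < eta)%R -> (Cmod (g z - g c) <= eps)%R) ->
  Ccont g c.
Proof.
intros H P [eps He].
destruct (H (eps / 2)%R) as [eta [Heta Hz]]; [generalize (cond_pos eps); lra |].
assert (H2 : (0 < sqrt 2)%R) by (apply sqrt_lt_R0; lra).
assert (Heta' : (0 < eta / sqrt 2)%R) by (apply Rdiv_lt_0_compat; lra).
exists (mkposreal _ Heta'); intros z Bz; apply He.
apply C_NormedModule_mixin_compat1.
apply Rle_lt_trans with (eps / 2)%R; [| generalize (cond_pos eps); lra].
apply Hz; replace eta with (sqrt 2 * mkposreal _ Heta')%R by (simpl; field; lra).
exact (C_NormedModule_mixin_compat2 c z _ Bz).
Qed.

Definition diff_quot (k k' : C -> C) (c z : C) : C :=
  if Ceq_dec z c then k' c else (k z - k c) / (z - c).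

(** The difference quotient minus $k'(c)$ is the mean of $k'-k'(c)$ over the
    segment from $c$ to $z$. *)
Lemma diff_quot_Ccont (k k' : C -> C) (c : C) :
  (forall z, holo k k' z) -> Ccont (diff_quot k k' c) c.
Proof.
intro H; apply eps_Ccont; intros eps Heps.
destruct (Ccont_eps k' c eps (proj1 (proj2 (H c))) Heps) as [eta [Heta Hk]].
exists eta; split; [exact Heta |].
intros z Hz; unfold diff_quot.
destruct (Ceq_dec c c) as [_ | N]; [| now elim N].
destruct (Ceq_dec z c) as [_ | N].
{ replace (k' c - k' c) with (RtoC 0) by ring; rewrite Cmod_0; lra. }
assert (N' : z - c <> 0).
{ intro E; apply N; replace z with (z - c + c) by ring; rewrite E; ring. }
set (g := fun t : R => c + t * (z - c)).
assert (Dg : forall t, cderive g t (z - c)).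
{ intro t; refine (cderive_eq _ _ _ _ (cderive_plus _ _ _ _ _ (cderive_const c t)
    (cderive_mult _ _ _ _ _
      (cderive_RtoC (fun t => t) t 1 (is_derive_id (K := R_AbsRing) t))
      (cderive_const (z - c) t))) _); ring. }
assert (Cg : forall t, Ccont (fun t => k' (g t)) t).
{ intro t; apply (Ccont_comp g); [exact (cderive_Ccont _ _ _ (Dg t)) | apply H]. }
assert (I : CInt (fun t => k' (g t) + - k' c) 0 1 = (k z - k c) / (z - c) - k' c).
{ rewrite CInt_plus by (intro t; ccont).
  rewrite CInt_const.
  assert (I : (z - c) * CInt (fun t => k' (g t)) 0 1 = k z - k c).
  { rewrite <- CInt_scal by exact Cg.
    rewrite (CInt_derive (fun t => k (g t))).
    - unfold g; f_equal; [f_equal; ring | do 2 f_equal; ring].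
    - intro t; eapply cderive_eq; [apply (proj2 (proj2 (H (g t)))); auto |]; ring.
    - intro t; ccont. }
  rewrite <- I, Rminus_0_r; field; exact N'. }
rewrite <- I; replace eps with ((1 - 0) * eps)%R by ring.
apply CInt_bound; [lra | intro t; ccont |].
intros t Ht; apply Hk; unfold g.
replace (c + t * (z - c) - c) with (t * (z - c)) by ring.
rewrite Cmod_mult, Cmod_R, Rabs_pos_eq by lra.
generalize (Cmod_ge_0 (z - c)); nra.
Qed.

Lemma holo_div (f f' g g' : C -> C) (z : C) :
  holo f f' z -> holo g g' z -> g z <> 0 ->
  holo (fun w => f w / g w) (fun w => f' w * / g w + f w * (- g' w / (g w * g w))) z.
Proof.
intros F G N; exact (holo_mult _ _ _ _ _ F (holo_inv _ _ _ G N)).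
Qed.

(** Near $c$ the quotient is $g$ divided by the difference quotient of $k$, over
    $z-c$, which is the form required by [circle_int_simple_pole]. *)
Lemma circle_int_simple_zero (g g' k k' : C -> C) (c : C) (r : R) :
  (Cmod c < r)%R ->
  (forall z, holo g g' z) -> (forall z, holo k k' z) ->
  k c = 0 -> k' c <> 0 ->
  (forall z, (Cmod z <= r)%R -> k z = 0 -> z = c) ->
  circle_int (fun z => g z / k z) r = 2 * PI * Ci * (g c / k' c).
Proof.
intros Hc Hg Hk kc k'c only.
replace (k' c) with (diff_quot k k' c c)
  by (unfold diff_quot; destruct (Ceq_dec c c) as [_ | N]; [reflexivity | now elim N]).
apply (circle_int_simple_pole _ _ (fun z => g z / diff_quot k k' c z) c r Hc
  (fun z Hz N => holo_div _ _ _ _ z (Hg z) (Hk z) (fun E => N (only z Hz E)))).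
- intros z Hz N; unfold diff_quot; destruct (Ceq_dec z c) as [E | _]; [now elim N |].
  rewrite kc; field; repeat split.
  + intro E; apply N; replace z with (z - c + c) by ring; rewrite E; ring.
  + intro E; apply N, (only z Hz E).
- apply (Ccont_mult g (fun z => / diff_quot k k' c z)); [exact (proj1 (Hg c)) |].
  apply Ccont_inv; [now apply diff_quot_Ccont |].
  unfold diff_quot; destruct (Ceq_dec c c) as [_ | N]; [exact k'c | now elim N].
Qed.

Lemma circle_int_ext (f g : C -> C) (r : R) :
  (0 <= r)%R -> (forall z, Cmod z = r -> f z = g z) -> circle_int f r = circle_int g r.
Proof.
intros Hr E; rewrite !circle_int_circ; apply CInt_ext; intro t.
now rewrite E by now apply Cmod_circ.
Qed.

Lemma circle_int_plus (f g : C -> C) (r : R) :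
  (0 <= r)%R -> (forall z, Cmod z = r -> Ccont f z) ->
  (forall z, Cmod z = r -> Ccont g z) ->
  circle_int (fun z => f z + g z) r = circle_int f r + circle_int g r.
Proof.
intros Hr F G; rewrite !circle_int_circ.
assert (D : forall h, (forall z, Cmod z = r -> Ccont h z) ->
  forall t, Ccont (fun t => h (circ r t) * (Ci * circ r t)) t).
{ intros h Hh t; ccont; apply (Ccont_comp (circ r)); [ccont |].
  apply Hh; now apply Cmod_circ. }
rewrite <- CInt_plus by now apply D.
apply CInt_ext; intro t; ring.
Qed.

(** * The residue theorem for the hyperbolic cotangent *)

(** The poles of $\coth$ in the disc of radius [cradius K], numbered from 0 to
    $2K$ from the lowest upwards, so that congruences modulo $2^n$ can be stated in
    [nat]. *)
Definition cpole (K m : nat) : C := Ci * ((INR m - INR K) * PI)%R.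
Definition cradius (K : nat) : R := ((2 * INR K + 1) * PI / 2)%R.

Lemma cradius_pos (K : nat) : (0 < cradius K)%R.
Proof.
unfold cradius; generalize (pos_INR K) PI_RGT_0; intros.
apply Rdiv_lt_0_compat; [nra | lra].
Qed.

Lemma pow2_pos (n : nat) : (0 < 2 ^ n)%R.
Proof. apply pow_lt; lra. Qed.

Lemma pow2_neq0 (n : nat) : RtoC (2 ^ n)%R <> 0.
Proof. intro E; apply RtoC_inj in E; generalize (pow2_pos n); lra. Qed.

Lemma Cmod_Ci_R (x : R) : Cmod (Ci * x) = Rabs x.
Proof.
rewrite Cmod_mult, Cmod_R; replace (Cmod Ci) with 1%R; [ring |].
unfold Cmod; simpl; rewrite <- sqrt_1 at 1; f_equal; ring.
Qed.

(** The zeros of $\sinh((\cdot-p_j)/2^n)$ are the poles $p_i$ with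
    $i\equiv j$ modulo $2^n$, where $i$ may be any integer. *)
Lemma Csinh_cpole_zero (K j n : nat) (z : C) :
  Csinh ((z - cpole K j) / (2 ^ n)%R) = 0 ->
  exists l : Z,
    z = Ci * (IZR (Z.of_nat j - Z.of_nat K + l * 2 ^ Z.of_nat n) * PI)%R.
Proof.
intros [l E]%Csinh_zero; exists l.
assert (E' : z = cpole K j + (2 ^ n)%R * (Ci * (IZR l * PI)%R)).
{ rewrite <- E; field; apply pow2_neq0. }
rewrite E'; unfold cpole; rewrite plus_IZR, minus_IZR, mult_IZR, <- pow_IZR, <- !INR_IZR_INZ.
rewrite !RtoC_mult, RtoC_plus, RtoC_mult; ring.
Qed.

(** The circle passes half-way between consecutive poles: $2|x|\le 2K+1$ forces
    $|x|\le K$, and $2|x|=2K+1$ is excluded by parity. *)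
Lemma cpole_index (K : nat) (x : Z) :
  (Cmod (Ci * (IZR x * PI)%R) <= cradius K)%R ->
  (- Z.of_nat K <= x <= Z.of_nat K)%Z /\ Cmod (Ci * (IZR x * PI)%R) <> cradius K.
Proof.
rewrite Cmod_Ci_R, Rabs_mult, (Rabs_pos_eq PI) by (generalize PI_RGT_0; lra).
rewrite <- abs_IZR.
unfold cradius; rewrite INR_IZR_INZ; intro H.
assert (P := PI_RGT_0).
assert (A : forall u v, (u * PI = v * PI / 2)%R -> (2 * u = v)%R).
{ intros u v E; apply (Rmult_eq_reg_r PI); lra. }
assert (B : (2 * IZR (Z.abs x) <= 2 * IZR (Z.of_nat K) + 1)%R).
{ apply (Rmult_le_reg_r PI); lra. }
rewrite <- mult_IZR, <- mult_IZR, <- plus_IZR in B; apply le_IZR in B.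
split; [lia |].
intro E; apply A in E; rewrite <- mult_IZR, <- mult_IZR, <- plus_IZR in E.
apply eq_IZR in E; lia.
Qed.

Lemma Csinh_cpole_neq0 (K j n : nat) (z : C) :
  Cmod z = cradius K -> Csinh ((z - cpole K j) / (2 ^ n)%R) <> 0.
Proof.
intros Hz [l E]%Csinh_cpole_zero; rewrite E in Hz.
destruct (cpole_index K _ (Req_le _ _ Hz)) as [_ N]; now apply N.
Qed.

(** The share of $h\coth$ that carries the poles $p_i$ with $i\equiv j$ modulo
    $2^n$, each with residue $h(p_i)$. *)
Definition dyadic_coth (h : C -> C) (K j n : nat) (z : C) : C :=
  h z * Ccoth ((z - cpole K j) / (2 ^ n)%R) / (2 ^ n)%R.

Lemma cpole_shift_double (K j n : nat) (z : C) :
  (z - cpole K (j + 2 ^ n)) / (2 ^ S n)%R =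
  (z - cpole K j) / (2 ^ S n)%R - Ci * (PI / 2)%R.
Proof.
unfold cpole; rewrite plus_INR, pow_INR.
replace (INR 2) with 2%R by (simpl; ring).
replace (2 ^ S n)%R with (2 * 2 ^ n)%R by reflexivity.
rewrite RtoC_div by lra.
rewrite !RtoC_mult, !RtoC_minus, RtoC_plus.
field; repeat split; auto using pow2_neq0, C2_neq0.
Qed.

Lemma dyadic_coth_split (h : C -> C) (K j n : nat) (z : C) :
  Cmod z = cradius K ->
  dyadic_coth h K j n z =
  dyadic_coth h K j (S n) z + dyadic_coth h K (j + 2 ^ n) (S n) z.
Proof.
intro Hz; unfold dyadic_coth; rewrite cpole_shift_double.
set (w := (z - cpole K j) / (2 ^ S n)%R).
assert (E : (z - cpole K j) / (2 ^ n)%R = w + w).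
{ unfold w; replace (2 ^ S n)%R with (2 * 2 ^ n)%R by reflexivity.
  rewrite RtoC_mult; field; repeat split; auto using pow2_neq0, C2_neq0. }
assert (N := Csinh_cpole_neq0 K j n z Hz); rewrite E in *.
rewrite (Ccoth_double w N).
replace (2 ^ S n)%R with (2 * 2 ^ n)%R by reflexivity.
rewrite RtoC_mult; field; repeat split; auto using pow2_neq0, C2_neq0.
Qed.

Lemma holo_scaled (p : C) (n : nat) (z : C) :
  holo (fun z => (z - p) / (2 ^ n)%R) (fun _ => / (2 ^ n)%R) z.
Proof.
apply (holo_ext (fun z => / (2 ^ n)%R * z + - p / (2 ^ n)%R)).
{ intro w; field; apply pow2_neq0. }
eapply holo_eq.
- apply holo_plus; [| apply holo_const].
  apply holo_mult; [apply holo_const | apply holo_id].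
- intro w; cbv beta; ring.
Qed.

Lemma dyadic_coth_Ccont (h h' : C -> C) (K j n : nat) (z : C) :
  holo h h' z -> Cmod z = cradius K -> Ccont (dyadic_coth h K j n) z.
Proof.
intros Hh Hz; unfold dyadic_coth, Cdiv, Ccoth.
assert (S := holo_scaled (cpole K j) n z).
apply Ccont_mult; [| apply Ccont_const].
apply Ccont_mult; [apply Hh |].
apply Ccont_mult; [apply (holo_Ccosh _ _ z S) |].
apply Ccont_inv; [apply (holo_Csinh _ _ z S) |].
now apply Csinh_cpole_neq0.
Qed.

Definition residue_sum (h : C -> C) (K j n : nat) : C :=
  sum_n (fun m => if Nat.eqb (m mod 2 ^ n) j then h (cpole K m) else RtoC 0) (2 * K).

(** A residue class modulo $2^n$ is the union of two classes modulo $2^{n+1}$,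
    parallel to [dyadic_coth_split]. *)
Lemma residue_sum_split (h : C -> C) (K j n : nat) :
  (j < 2 ^ n)%nat ->
  residue_sum h K j n = residue_sum h K j (S n) + residue_sum h K (j + 2 ^ n) (S n).
Proof.
intro Hj; unfold residue_sum.
rewrite <- (sum_n_plus (G := C_AbelianMonoid)); apply sum_n_ext; intro m.
match goal with |- _ = plus ?a ?b => change (plus a b) with (a + b) end.
assert (D : (2 ^ n <> 0)%nat) by (apply Nat.pow_nonzero; lia).
assert (E : (m mod 2 ^ S n = m mod 2 ^ n + 2 ^ n * ((m / 2 ^ n) mod 2))%nat).
{ rewrite Nat.pow_succ_r', (Nat.mul_comm 2); apply Nat.Div0.mod_mul_r. }
assert (L := Nat.mod_upper_bound m (2 ^ n) D).
assert (L2 := Nat.mod_upper_bound (m / 2 ^ n) 2 ltac:(lia)).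
rewrite E; destruct ((m / 2 ^ n) mod 2)%nat as [|[|]]; [| | lia];
  destruct (Nat.eqb_spec (m mod 2 ^ n) j);
  destruct (Nat.eqb_spec (m mod 2 ^ n + 2 ^ n * 0) j);
  destruct (Nat.eqb_spec (m mod 2 ^ n + 2 ^ n * 0) (j + 2 ^ n));
  destruct (Nat.eqb_spec (m mod 2 ^ n + 2 ^ n * 1) j);
  destruct (Nat.eqb_spec (m mod 2 ^ n + 2 ^ n * 1) (j + 2 ^ n));
  try lia; toC; ring.
Qed.

Lemma sum_n_delta (f : nat -> C) (j M : nat) :
  sum_n (fun m => if Nat.eqb m j then f m else RtoC 0) M =
  if Nat.leb j M then f j else RtoC 0.
Proof.
induction M as [|M IH].
- rewrite sum_O; destruct j; reflexivity.
- rewrite sum_Sn, IH.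
  match goal with |- plus ?a ?b = _ => change (plus a b) with (a + b) end.
  destruct (Nat.leb_spec j M), (Nat.eqb_spec (S M) j), (Nat.leb_spec j (S M));
    try lia; subst; toC; ring.
Qed.

(** The poles of this share are $2^n\pi$ apart and the numbers 0 to $2K$ are
    distinct modulo $2^n$, so the disc contains $p_j$ if $j\le 2K$ and otherwise
    no pole at all. *)
Lemma dyadic_coth_base (h h' : C -> C) (K j n : nat) :
  (forall z, holo h h' z) -> (j < 2 ^ n)%nat -> (2 * K < 2 ^ n)%nat ->
  circle_int (dyadic_coth h K j n) (cradius K) = 2 * PI * Ci * residue_sum h K j n.
Proof.
intros Hh Hj HK.
assert (Hs : residue_sum h K j n = if Nat.leb j (2 * K) then h (cpole K j) else 0).
{ unfold residue_sum; rewrite <- (sum_n_delta (fun m => h (cpole K m))).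
  apply sum_n_ext_loc; intros m Hm; now rewrite Nat.mod_small by lia. }
set (w := fun z => (z - cpole K j) / (2 ^ n)%R).
assert (Dw : forall z, holo w (fun _ => / (2 ^ n)%R) z) by (intro; apply holo_scaled).
assert (Dsinh := fun z => holo_Csinh _ _ z (Dw z)).
assert (Dnum := fun z => holo_mult _ _ _ _ _
  (holo_mult _ _ _ _ _ (Hh z) (holo_Ccosh _ _ z (Dw z))) (holo_const (/ (2 ^ n)%R) z)).
assert (E : dyadic_coth h K j n =
  (fun z => h z * Ccosh (w z) * / (2 ^ n)%R / Csinh (w z))).
{ apply functional_extensionality; intro z; unfold dyadic_coth, Ccoth, w, Cdiv; ring. }
assert (only : forall z, (Cmod z <= cradius K)%R -> Csinh (w z) = 0 ->
  (j <= 2 * K)%nat /\ z = cpole K j).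
{ intros z Hz [l El]%Csinh_cpole_zero; rewrite El in Hz.
  apply cpole_index in Hz as [Hz _].
  assert (HK' : (Z.of_nat (2 * K) < 2 ^ Z.of_nat n)%Z).
  { change 2%Z with (Z.of_nat 2); rewrite <- Znat.Nat2Z.inj_pow; lia. }
  assert (Hj' : (Z.of_nat j < 2 ^ Z.of_nat n)%Z).
  { change 2%Z with (Z.of_nat 2); rewrite <- Znat.Nat2Z.inj_pow; lia. }
  (* 0 <= j + l 2^n <= 2 K < 2^n and 0 <= j < 2^n. *)
  assert (l0 : l = 0%Z) by nia; subst l; split; [lia |].
  rewrite El; unfold cpole; do 3 f_equal.
  rewrite Z.mul_0_l, Z.add_0_r, minus_IZR, <- !INR_IZR_INZ; reflexivity. }
assert (P0 := cradius_pos K).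
rewrite E, Hs; destruct (Nat.leb_spec j (2 * K)) as [Hle | Hgt].
- assert (inside : (Cmod (cpole K j) < cradius K)%R).
  { unfold cpole; rewrite Cmod_Ci_R, Rabs_mult, (Rabs_pos_eq PI)
      by (generalize PI_RGT_0; lra).
    apply le_INR in Hle; rewrite mult_INR in Hle; simpl in Hle.
    assert (Rabs (INR j - INR K) <= INR K)%R
      by (apply Rabs_le; generalize (pos_INR j); lra).
    unfold cradius; generalize PI_RGT_0; nra. }
  assert (w0 : w (cpole K j) = 0).
  { unfold w; field; apply pow2_neq0. }
  rewrite (circle_int_simple_zero _ _ _ _ (cpole K j) (cradius K)
    inside Dnum Dsinh).
  + rewrite w0, Ccosh_0; field; apply pow2_neq0.
  + rewrite w0; apply Csinh_0.
  + rewrite w0, Ccosh_0, Cmult_1_l; intro I0.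
    assert (I1 := Cinv_r _ (pow2_neq0 n)); rewrite I0, Cmult_0_r in I1.
    apply RtoC_inj in I1; lra.
  + intros z Hz Ez; now apply only.
- rewrite Cmult_0_r; eapply circle_int_holo; [lra |].
  intros z Hz; apply (holo_div _ _ _ _ z (Dnum z) (Dsinh z)).
  intro Ez; destruct (only z Hz Ez); lia.
Qed.

(** The induction runs downwards in $n$, starting from [dyadic_coth_base]; [d]
    is the number of halvings still to be done. *)
Lemma dyadic_coth_residues (h h' : C -> C) (K d j n : nat) :
  (forall z, holo h h' z) -> (j < 2 ^ n)%nat -> (2 * K < 2 ^ (n + d))%nat ->
  circle_int (dyadic_coth h K j n) (cradius K) = 2 * PI * Ci * residue_sum h K j n.
Proof.
intro Hh; revert j n; induction d as [|d IH]; intros j n Hj HK.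
- rewrite Nat.add_0_r in HK; now apply (dyadic_coth_base h h').
- rewrite residue_sum_split by exact Hj.
  rewrite (circle_int_ext _ (fun z => dyadic_coth h K j (S n) z +
     dyadic_coth h K (j + 2 ^ n) (S n) z)).
  + rewrite circle_int_plus, !IH; try ring; try (simpl; lia);
      try (rewrite Nat.add_succ_l, <- Nat.add_succ_r; exact HK).
    * left; apply cradius_pos.
    * intros z; now apply (dyadic_coth_Ccont h h').
    * intros z; now apply (dyadic_coth_Ccont h h').
  + left; apply cradius_pos.
  + apply dyadic_coth_split.
Qed.

(** At $n=0$ and $j=0$ the share is $h(\zeta)\coth(\zeta+\mathrm{i}K\pi)$, which is
    $h\coth$ by periodicity. *)
Lemma circle_int_coth (h h' : C -> C) (K : nat) :
  (forall z, holo h h' z) ->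
  circle_int (fun z => h z * Ccoth z) (cradius K) =
  2 * PI * Ci * sum_n (fun m => h (cpole K m)) (2 * K).
Proof.
intro Hh.
assert (HK : (2 * K < 2 ^ (0 + 2 * K))%nat) by (apply Nat.pow_gt_lin_r; lia).
assert (D := dyadic_coth_residues h h' K (2 * K) 0 0 Hh ltac:(simpl; lia) HK).
replace (residue_sum h K 0 0) with (sum_n (fun m => h (cpole K m)) (2 * K)) in D.
- rewrite <- D; f_equal; apply functional_extensionality; intro z.
  unfold dyadic_coth; rewrite <- (Ccoth_PI_nat K z).
  replace ((z - cpole K 0) / (2 ^ 0)%R) with (z + Ci * (INR K * PI)).
  + simpl pow; field; intro E; apply RtoC_inj in E; lra.
  + unfold cpole; simpl; rewrite RtoC_mult, RtoC_minus; field.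
- unfold residue_sum; apply sum_n_ext; intro m.
  rewrite Nat.pow_0_r, Nat.mod_1_r; reflexivity.
Qed.

(** * Derivatives along rays *)

(** The derivative of [f] at $sz$ in the direction $z$ only.  This is all that the
    uniqueness argument needs, and it only involves a single real parameter
    under the integral sign. *)
Definition ray_derive (f f' : C -> C) : Prop :=
  forall (z : C) (s : R), cderive (fun s => f (s * z)) s (z * f' (s * z)).

Lemma cderive_ray (z : C) (s : R) : cderive (fun s => s * z) s z.
Proof.
refine (cderive_eq _ _ _ _ (cderive_mult _ _ _ _ _
  (cderive_RtoC (fun t => t) s 1 (is_derive_id (K := R_AbsRing) s))
  (cderive_const z s)) _); ring.
Qed.

Lemma holo_ray_derive (f f' : C -> C) : (forall z, holo f f' z) -> ray_derive f f'.
Proof.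
intros H z s; eapply cderive_eq.
- apply (proj2 (proj2 (H (s * z))) (fun s => s * z)); [reflexivity | apply cderive_ray].
- ring.
Qed.

Lemma ray_derive_plus (f f' g g' : C -> C) :
  ray_derive f f' -> ray_derive g g' ->
  ray_derive (fun z => f z + g z) (fun z => f' z + g' z).
Proof.
intros F G z s; eapply cderive_eq; [apply (cderive_plus _ _ _ _ _ (F z s) (G z s)) | ring].
Qed.

Lemma ray_derive_scal (c : C) (f f' : C -> C) :
  ray_derive f f' -> ray_derive (fun z => c * f z) (fun z => c * f' z).
Proof.
intros F z s; eapply cderive_eq;
  [apply (cderive_mult _ _ _ _ _ (cderive_const c s) (F z s)) | ring].
Qed.

(** The function [f'] is constant along rays, hence constant, so [f] is linear:
    $f(z)=z f'(0)$.  The value at 1 then gives $f'(0)=0$. *)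
Lemma ray_affine_zero (f f' : C -> C) :
  ray_derive f f' -> ray_derive f' (fun _ => 0) -> f 0 = 0 -> f 1 = 0 ->
  forall z, f z = 0.
Proof.
intros F F' f0 f1.
assert (K : forall z, f' z = f' 0).
{ intro z; assert (E : f' (1%R * z) = f' (0%R * z)).
  { apply (cderive_zero (fun s => f' (s * z))); intro s.
    eapply cderive_eq; [apply F' | ring]. }
  replace (1%R * z) with z in E by ring; now replace (0%R * z) with (RtoC 0) in E by ring. }
assert (L : forall z, f z = z * f' 0).
{ intro z.
  assert (E : f (1%R * z) + - (1%R * z) * f' 0 = f (0%R * z) + - (0%R * z) * f' 0).
  { apply (cderive_zero (fun s => f (s * z) + - (s * z) * f' 0)); intro s.
    apply (cderive_ext (fun s => f (s * z) + (s * z) * - f' 0)); [intro; ring |].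
    eapply cderive_eq.
    - apply cderive_plus; [apply F |].
      apply cderive_mult; [apply cderive_ray | apply cderive_const].
    - rewrite K; ring. }
  replace (1%R * z) with z in E by ring; replace (0%R * z) with (RtoC 0) in E by ring.
  rewrite f0 in E; replace (f z) with (f z + - z * f' 0 + z * f' 0) by ring.
  rewrite E; ring. }
intro z; rewrite L; replace (f' 0) with (f 1) by (rewrite L; ring).
rewrite f1; ring.
Qed.

Lemma ray_derive_CInt (phi phi' : C -> C) (W zeta : R -> C) (a b : R) :
  (forall z, holo phi phi' z) -> (forall t, Ccont W t) -> (forall t, Ccont zeta t) ->
  ray_derive (fun z => CInt (fun t => W t * phi (zeta t * z)) a b)
             (fun z => CInt (fun t => W t * zeta t * phi' (zeta t * z)) a b).
Proof.
intros H CW Cz z s.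
rewrite <- CInt_scal.
- apply (cderive_CInt_param (fun s t => W t * phi (zeta t * (s * z)))
    (fun s t => z * (W t * zeta t * phi' (zeta t * (s * z))))); clear s.
  + intros s t; eapply cderive_eq.
    * apply cderive_mult; [apply cderive_const |].
      apply (proj2 (proj2 (H (zeta t * (s * z)))) (fun s => zeta t * (s * z)));
        [reflexivity |].
      apply cderive_mult; [apply cderive_const | apply cderive_ray].
    * cbv beta; ring.
  + intros s t.
    assert (Kr : forall r : R -> C, (forall t, Ccont r t) ->
       Ccont (fun p : R * R => r (snd p)) (s, t)).
    { intros r Hr; apply (Ccont_real_comp snd r); [apply continuous_snd | apply Hr]. }
    assert (KW := Kr _ CW); assert (Kz := Kr _ Cz).
    assert (Ks : Ccont (fun p : R * R => RtoC (fst p)) (s, t)).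
    { apply Ccont_RtoC, continuous_fst. }
    ccont; apply (Ccont_comp (fun p : R * R => zeta (snd p) * (fst p * z)));
      [ccont | exact (proj1 (proj2 (H _)))].
  + intros s t; ccont; apply (Ccont_comp (fun t => zeta t * (s * z)));
      [ccont | exact (proj1 (H _))].
- intro t; ccont; apply (Ccont_comp (fun t => zeta t * (s * z)));
    [ccont | exact (proj1 (proj2 (H _)))].
Qed.

(** * Second derivatives of the polynomial terms *)

Lemma holo_monomial (c : C) (n : nat) (z : C) :
  holo (fun w => c * w ^ S n) (fun w => INR (S n) * c * w ^ n) z.
Proof.
induction n as [|n IH].
- eapply holo_ext; [| eapply holo_eq].
  2: exact (holo_mult _ _ _ _ z (holo_const c z) (holo_id z)).
  + intro w; simpl; ring.
  + intro w; simpl; ring.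
- eapply holo_ext; [| eapply holo_eq].
  2: exact (holo_mult _ _ _ _ z (holo_id z) IH).
  + intro w; simpl; ring.
  + intro w; cbv beta; rewrite (S_INR (S n)), RtoC_plus; simpl; ring.
Qed.

Lemma holo_poly_fun (a : nat -> C) (n : nat) (z : C) :
  holo (poly_fun a (S n)) (poly_fun (deriv_coef a) n) z.
Proof.
induction n as [|n IH].
- eapply holo_ext; [| eapply holo_eq].
  2: exact (holo_plus _ _ _ _ z (holo_const (a O) z) (holo_monomial (a 1%nat) 0 z)).
  + intro w; now rewrite poly_fun_S, poly_fun_0.
  + intro w; rewrite poly_fun_0; unfold deriv_coef; simpl; ring.
- eapply holo_ext; [| eapply holo_eq].
  2: exact (holo_plus _ _ _ _ z IH (holo_monomial (a (S (S n))) (S n) z)).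
  + intro w; now rewrite (poly_fun_S a (S n)).
  + intro w; now rewrite poly_fun_S.
Qed.

Definition cpow_fact (n : nat) (z : C) : C := z ^ n / INR (fact n).

Lemma INR_fact_neq0 (n : nat) : RtoC (INR (fact n)) <> 0.
Proof. intro E; apply RtoC_inj in E; now apply (INR_fact_neq_0 n). Qed.

Lemma holo_cpow_fact (n : nat) (z : C) : holo (cpow_fact (S n)) (cpow_fact n) z.
Proof.
eapply holo_ext; [| eapply holo_eq].
2: exact (holo_monomial (/ INR (fact (S n))) n z).
- intro w; unfold cpow_fact, Cdiv; ring.
- intro w; unfold cpow_fact; cbv beta.
  rewrite fact_simpl, mult_INR, RtoC_mult; field.
  split; [apply INR_fact_neq0 | apply INR_S_neq0].
Qed.

Lemma holo_cpow_fact_0 (z : C) : holo (cpow_fact 0) (fun _ => 0) z.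
Proof.
apply (holo_ext (fun _ => 1)); [| apply holo_const].
intro w; unfold cpow_fact; simpl; field; apply INR_fact_neq0.
Qed.

(** The second derivative of $\Lambda_{2k,0}$; see
    [Lidstone0_second_derive]. *)
Definition Lidstone_step (k : nat) : C -> C :=
  match k with O => fun _ => 0 | S j => Lidstone0 (2 * j) end.

Lemma Even_double (k : nat) : Nat.Even (2 * k).
Proof. now exists k. Qed.

(** The values of the second derivative are the original ones shifted by two
    orders.  They characterize $\Lambda_{2k-2,0}$ if $k>0$; if $k=0$ they all vanish,
    and so does the polynomial. *)
Lemma Lidstone0_second_derive (k : nat) :
  exists P1 : C -> C, (forall z, holo (Lidstone0 (2 * k)) P1 z) /\
    (forall z, holo P1 (Lidstone_step k) z).
Proof.
destruct (Lidstone0_spec _ (Even_double k)) as [[n [a HP]] D].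
set (b := fun i => if Nat.leb i n then a i else 0).
assert (EP : Lidstone0 (2 * k) = poly_fun b (S (S n))).
{ apply functional_extensionality; intro z; rewrite HP.
  replace (S (S n)) with (n + 2)%nat by lia; symmetry; apply poly_fun_pad. }
exists (poly_fun (deriv_coef b) (S n)).
split; [intro z; rewrite EP; apply holo_poly_fun |].
set (c := deriv_coef (deriv_coef b)).
assert (Dc : forall tau, Nat.Even tau ->
  C_derive_n tau (poly_fun c n) 0 = (if Nat.eqb (2 * k) (S (S tau)) then 1 else 0) /\
  C_derive_n tau (poly_fun c n) 1 = 0).
{ intros tau Ht; unfold c; rewrite <- !C_derive_poly_fun, <- !C_derive_n_S, <- EP.
  apply D; destruct Ht as [i ->]; exists (S i); lia. }
replace (Lidstone_step k) with (poly_fun c n); [intro z; apply holo_poly_fun |].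
destruct k as [|k]; simpl Lidstone_step.
- assert (c0 : forall i, (i <= n)%nat -> c i = 0) by (apply lidstone_vanish; exact Dc).
  apply functional_extensionality; intro z; unfold poly_fun.
  rewrite (sum_n_ext_loc _ (fun _ => RtoC 0)); [apply sum_n_C0 |].
  intros i Hi; rewrite c0 by exact Hi; toC; ring.
- apply (is_Lidstone0_unique (2 * k)); [| apply Lidstone0_spec, Even_double].
  split; [now exists n, c |].
  intros tau Ht; destruct (Dc tau Ht) as [-> ->]; split; [| reflexivity].
  replace (2 * S k)%nat with (S (S (2 * k))) by lia; reflexivity.
Qed.

(** * The moments of the hyperbolic cosine *)

Lemma circ_neq0 (r t : R) : (0 < r)%R -> circ r t <> 0.
Proof.
intros Hr E; assert (M := Cmod_circ r t); rewrite E, Cmod_0 in M; lra.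
Qed.

(** The fundamental theorem of calculus along a closed curve. *)
Lemma circle_int_derive (f f' : C -> C) (r : R) :
  (0 <= r)%R -> (forall z, Cmod z = r -> holo f f' z) -> circle_int f' r = 0.
Proof.
intros Hr H; rewrite circle_int_circ.
assert (H' : forall t, holo f f' (circ r t)) by (intro t; now apply H, Cmod_circ).
rewrite (CInt_derive (fun t => f (circ r t))).
- rewrite circ_closed; ring.
- intro t; apply (proj2 (proj2 (H' t))); [reflexivity | apply circ_cderive].
- intro t; ccont; apply (Ccont_comp (circ r)); [ccont |].
  exact (proj1 (proj2 (H' t))).
Qed.

Lemma circle_int_scal (c : C) (f : C -> C) (r : R) :
  (0 <= r)%R -> (forall z, Cmod z = r -> Ccont f z) ->
  circle_int (fun z => c * f z) r = c * circle_int f r.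
Proof.
intros Hr F; rewrite !circle_int_circ, <- CInt_scal.
- apply CInt_ext; intro t; ring.
- intro t; ccont; apply (Ccont_comp (circ r)); [ccont |].
  now apply F, Cmod_circ.
Qed.

Lemma holo_pow (n : nat) (z : C) :
  holo (fun w => w ^ S n) (fun w => INR (S n) * w ^ n) z.
Proof.
eapply holo_ext; [| eapply holo_eq].
2: exact (holo_monomial 1 n z).
- intro w; cbv beta; ring.
- intro w; cbv beta; ring.
Qed.

Lemma Cmod_pos_neq0 (z : C) : (0 < Cmod z)%R -> z <> 0.
Proof. intros H E; rewrite E, Cmod_0 in H; lra. Qed.

(** Integration by parts: the derivative of $f(z)/z^{n+1}$ has integral zero. *)
Lemma circle_int_moment_step (f f' : C -> C) (r : R) (n : nat) :
  (0 < r)%R -> (forall z, Cmod z = r -> holo f f' z) ->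
  INR (S n) * circle_int (fun z => f z / z ^ S (S n)) r =
  circle_int (fun z => f' z / z ^ S n) r.
Proof.
intros Hr H.
assert (N : forall z, Cmod z = r -> forall k, z ^ k <> 0).
{ intros z Hz k; apply Cpow_nz, Cmod_pos_neq0; lra. }
assert (D : forall z, Cmod z = r -> holo (fun z => f z / z ^ S n)
  (fun z => f' z / z ^ S n + - INR (S n) * (z ^ n * f z / (z ^ S n * z ^ S n))) z).
{ intros z Hz; eapply holo_eq.
  - apply (holo_div _ _ _ _ z (H z Hz) (holo_pow n z)), N, Hz.
  - intro w; cbv beta; unfold Cdiv; ring. }
assert (E : circle_int (fun z => f' z / z ^ S n + - INR (S n) * (f z / z ^ S (S n))) r = 0).
{ rewrite <- (circle_int_derive _ _ r (Rlt_le _ _ Hr) D).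
  apply circle_int_ext; [lra |]; intros z Hz.
  assert (N1 := N z Hz 1%nat); assert (Nn := N z Hz n); rewrite Cpow_1_r in N1.
  simpl; field; now split. }
assert (C1 : forall z, Cmod z = r -> Ccont (fun z => f' z / z ^ S n) z).
{ intros z Hz; apply (Ccont_mult f' (fun z => / z ^ S n)).
  - exact (proj1 (proj2 (H z Hz))).
  - apply (Ccont_inv (fun z => z ^ S n)); [exact (proj1 (holo_pow n z)) | now apply N]. }
assert (C2 : forall z, Cmod z = r -> Ccont (fun z => f z / z ^ S (S n)) z).
{ intros z Hz; apply (Ccont_mult f (fun z => / z ^ S (S n))).
  - exact (proj1 (H z Hz)).
  - apply (Ccont_inv (fun z => z ^ S (S n))); [exact (proj1 (holo_pow (S n) z)) | now apply N]. }
rewrite circle_int_plus, circle_int_scal in E; auto; try lra.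
- match type of E with ?A + - ?B * ?D = _ => replace A with (A + - B * D + B * D) by ring end.
  rewrite E; ring.
- intros z Hz; ccont; now apply C2.
Qed.

(** Two integrations by parts divide by $(2m+1)(2m+2)$ and lower the exponent by
    2, down to the simple pole of $\cosh z/z$. *)
Lemma circle_int_cosh_moment (r : R) (m : nat) :
  (0 < r)%R ->
  circle_int (fun z => Ccosh z / z ^ S (2 * m)) r = 2 * PI * Ci / INR (fact (2 * m)).
Proof.
intro Hr.
induction m as [|m IH].
- rewrite (circle_int_ext _ (fun z => Ccosh z / z)); [| lra |].
  + rewrite (circle_int_simple_zero Ccosh Csinh (fun z => z) (fun _ => 1) 0 r);
      auto using holo_Ccosh_id.
    * rewrite Ccosh_0; simpl; field.
    * rewrite Cmod_0; exact Hr.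
    * intro; apply holo_id.
    * intro E; apply RtoC_inj in E; lra.
  + intros z _; rewrite Cpow_1_r; reflexivity.
- replace (2 * S m)%nat with (S (S (2 * m))) by lia.
  assert (E1 := circle_int_moment_step Ccosh Csinh r (S (2 * m)) Hr
    (fun z _ => holo_Ccosh_id z)).
  assert (E2 := circle_int_moment_step Csinh Ccosh r (2 * m) Hr
    (fun z _ => holo_Csinh_id z)).
  rewrite IH, <- E1 in E2.
  rewrite !fact_simpl, !mult_INR, !RtoC_mult.
  match goal with |- ?I = _ =>
    replace I with (INR (S (2 * m)) * (INR (S (S (2 * m))) * I)
      / (INR (S (2 * m)) * INR (S (S (2 * m))))) by (field; split; apply INR_S_neq0) end.
  rewrite E2; field; repeat split; auto using INR_S_neq0, INR_fact_neq0.
Qed.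

(** * The defect of the identity *)

(** This is $z^{1-2m}$.  The form is chosen so that [pole_weight_step] also holds
    at $z=0$, where inversion returns 0; then the pole at the origin needs no
    separate treatment in [residue_part]. *)
Definition pole_weight (m : nat) (z : C) : C := z * (/ (z * z)) ^ m.

Definition contour_part (K m : nat) (z : C) : C :=
  circle_int (fun w => pole_weight m w * Csinh (w * z) * Ccoth w) (cradius K).

Definition residue_part (K m : nat) (z : C) : C :=
  sum_n (fun j => pole_weight m (cpole K j) * Csinh (cpole K j * z)) (2 * K).

(** The index is shifted so that $m=k+1$ stands for $t=2k$, and $m=0$ for the
    second derivative of the case $t=0$. *)
Definition polynomial_part (m : nat) (z : C) : C :=
  match m with O => 0 | S k => Lidstone0 (2 * k) z - cpow_fact (2 * k) z end.

Definition defect (K m : nat) (z : C) : C :=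
  polynomial_part m z - residue_part K m z + / (2 * PI * Ci) * contour_part K m z.

Lemma two_PI_Ci_neq0 : 2 * PI * Ci <> 0.
Proof.
apply Cmult_neq_0; [apply Cmult_neq_0 | apply Ci_neq0]; [apply C2_neq0 |].
intro E; apply RtoC_inj in E; generalize PI_RGT_0; lra.
Qed.

Lemma pole_weight_step (m : nat) (z : C) : pole_weight (S m) z * z * z = pole_weight m z.
Proof.
unfold pole_weight; destruct (Ceq_dec z 0) as [-> | N]; [simpl; ring |].
rewrite Cpow_S; field; exact N.
Qed.

Lemma pole_weight_S (m : nat) (z : C) : z <> 0 -> pole_weight (S m) z = / z ^ S (2 * m).
Proof.
intro N; unfold pole_weight; induction m as [|m IH].
- simpl; field; exact N.
- rewrite Cpow_S; replace (2 * S m)%nat with (S (S (2 * m))) by lia.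
  replace (z * (/ (z * z) * (/ (z * z)) ^ S m))
    with (/ (z * z) * (z * (/ (z * z)) ^ S m)) by ring.
  rewrite IH; assert (Z := Cpow_nz z (2 * m) N).
  simpl; simpl in Z; field; now split.
Qed.

Lemma Csinh_circ_neq0 (K : nat) (z : C) : Cmod z = cradius K -> Csinh z <> 0.
Proof.
intros Hz E; apply Csinh_zero in E as [k E].
rewrite E in Hz; now destruct (cpole_index K k (Req_le _ _ Hz)).
Qed.

Lemma pole_weight_Ccoth_Ccont (K m : nat) (t : R) :
  Ccont (fun t => pole_weight m (circ (cradius K) t) * Ccoth (circ (cradius K) t)) t.
Proof.
assert (P := cradius_pos K).
set (r := cradius K) in *.
assert (Cpw : forall (f : R -> C) n, (forall t, Ccont f t) ->
  forall t, Ccont (fun t => f t ^ n) t).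
{ intros f n Hf; induction n as [|n IH]; intro t'; [apply Ccont_const |].
  apply (Ccont_mult f (fun t => f t ^ n)); auto. }
unfold pole_weight, Ccoth, Cdiv.
ccont.
- apply (Cpw (fun t => / (circ r t * circ r t))); intro t'.
  apply (Ccont_inv (fun t => circ r t * circ r t)); [ccont |].
  apply Cmult_neq_0; now apply circ_neq0.
- apply (Ccont_comp (circ r)); [ccont | exact (proj1 (holo_Ccosh_id _))].
- apply (Ccont_inv (fun t => Csinh (circ r t))).
  + apply (Ccont_comp (circ r)); [ccont | exact (proj1 (holo_Csinh_id _))].
  + apply (Csinh_circ_neq0 K); apply Cmod_circ; fold r; lra.
Qed.

Lemma contour_part_second_derive (K m : nat) :
  exists f1, ray_derive (contour_part K (S m)) f1 /\ ray_derive f1 (contour_part K m).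
Proof.
set (r := cradius K).
set (W := fun t => pole_weight (S m) (circ r t) * Ccoth (circ r t) * (Ci * circ r t)).
assert (CW : forall t, Ccont W t).
{ intro t; apply Ccont_mult; [apply pole_weight_Ccoth_Ccont | ccont]. }
assert (CW1 : forall t, Ccont (fun t => W t * circ r t) t) by (intro t; ccont).
exists (fun z => CInt (fun t => W t * circ r t * Ccosh (circ r t * z)) 0 (2 * PI)).
split.
- replace (contour_part K (S m)) with
    (fun z => CInt (fun t => W t * Csinh (circ r t * z)) 0 (2 * PI)).
  + apply ray_derive_CInt; [apply holo_Csinh_id | exact CW | apply circ_Ccont].
  + apply functional_extensionality; intro z; unfold contour_part.
    rewrite circle_int_circ; apply CInt_ext; intro t; unfold W; fold r; ring.
- replace (contour_part K m) with
    (fun z => CInt (fun t => W t * circ r t * circ r t * Csinh (circ r t * z)) 0 (2 * PI)).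
  + apply (ray_derive_CInt Ccosh Csinh); [apply holo_Ccosh_id | exact CW1 | apply circ_Ccont].
  + apply functional_extensionality; intro z; unfold contour_part.
    rewrite circle_int_circ; apply CInt_ext; intro t.
    rewrite <- (pole_weight_step m); unfold W; fold r; ring.
Qed.

Lemma ray_derive_sum_n (f f' : nat -> C -> C) (n : nat) :
  (forall j, ray_derive (f j) (f' j)) ->
  ray_derive (fun z => sum_n (fun j => f j z) n) (fun z => sum_n (fun j => f' j z) n).
Proof.
intro H; induction n as [|n IH].
- intros z s; rewrite sum_O; apply (cderive_ext (fun s => f O (s * z))); [| apply H].
  intro; now rewrite sum_O.
- intros z s; rewrite sum_Sn.
  apply (cderive_ext (fun s => sum_n (fun j => f j (s * z)) n + f (S n) (s * z))).
  + intro; now rewrite sum_Sn.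
  + apply (ray_derive_plus _ _ _ _ IH (H (S n))).
Qed.

Lemma residue_part_second_derive (K m : nat) :
  exists f1, ray_derive (residue_part K (S m)) f1 /\ ray_derive f1 (residue_part K m).
Proof.
set (p := cpole K).
exists (fun z => sum_n (fun j => pole_weight (S m) (p j) * p j * Ccosh (p j * z)) (2 * K)).
split.
- apply (ray_derive_sum_n (fun j z => pole_weight (S m) (p j) * Csinh (p j * z))).
  intro j; apply holo_ray_derive; intro z; eapply holo_eq.
  + apply holo_mult; [apply holo_const |].
    apply (holo_Csinh (fun z => p j * z)), holo_mult; [apply holo_const | apply holo_id].
  + intro w; cbv beta; ring.
- apply (ray_derive_sum_n (fun j z => pole_weight (S m) (p j) * p j * Ccosh (p j * z))
    (fun j z => pole_weight m (p j) * Csinh (p j * z))).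
  intro j; apply holo_ray_derive; intro z; eapply holo_eq.
  + apply holo_mult; [apply holo_const |].
    apply (holo_Ccosh (fun z => p j * z)), holo_mult; [apply holo_const | apply holo_id].
  + intro w; cbv beta; rewrite <- (pole_weight_step m); ring.
Qed.

Lemma polynomial_part_second_derive (m : nat) :
  exists f1, ray_derive (polynomial_part (S m)) f1 /\ ray_derive f1 (polynomial_part m).
Proof.
destruct (Lidstone0_second_derive m) as [P1 [D1 D2]].
assert (T : exists T1, (forall z, holo (cpow_fact (2 * m)) T1 z) /\
  forall z, holo T1 (fun z => Lidstone_step m z - polynomial_part m z) z).
{ destruct m as [|m].
  - exists (fun _ => 0); split; [apply holo_cpow_fact_0 |].
    intro z; eapply holo_eq; [apply holo_const | intro w; simpl; ring].
  - replace (2 * S m)%nat with (S (S (2 * m))) by lia.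
    exists (cpow_fact (S (2 * m))); split; [apply holo_cpow_fact |].
    intro z; eapply holo_eq; [apply holo_cpow_fact |].
    intro w; unfold polynomial_part, Lidstone_step; ring. }
destruct T as [T1 [E1 E2]].
exists (fun z => P1 z + - (1) * T1 z); split; apply holo_ray_derive; intro z.
- apply (holo_ext (fun z => Lidstone0 (2 * m) z + - (1) * cpow_fact (2 * m) z)).
  { intro w; unfold polynomial_part; ring. }
  eapply holo_eq.
  { apply (holo_plus _ _ _ _ z (D1 z)
      (holo_mult _ _ _ _ z (holo_const _ z) (E1 z))). }
  intro w; cbv beta; ring.
- eapply holo_eq.
  { apply (holo_plus _ _ _ _ z (D2 z)
      (holo_mult _ _ _ _ z (holo_const _ z) (E2 z))). }
  intro w; cbv beta; ring.
Qed.

Lemma sum_n_0 (f : nat -> C) (n : nat) : (forall j, f j = 0) -> sum_n f n = RtoC 0.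
Proof.
intro H; rewrite (sum_n_ext _ (fun _ => RtoC 0)) by exact H; apply sum_n_C0.
Qed.

Lemma defect_0 (K m : nat) : defect K (S m) 0 = 0.
Proof.
destruct (Lidstone0_spec _ (Even_double m)) as [_ D].
destruct (D 0%nat) as [D0 _]; [now exists 0%nat |]; cbn [C_derive_n] in D0.
unfold defect, residue_part, contour_part, polynomial_part.
rewrite sum_n_0 by (intro j; rewrite Cmult_0_r, Csinh_0; ring).
rewrite (circle_int_ext _ (fun _ => 0)).
- rewrite (circle_int_holo (fun _ => 0) (fun _ => 0)).
  + rewrite D0; unfold cpow_fact; generalize (/ (2 * PI * Ci)); intro q.
    destruct m as [|m].
    * simpl; field.
    * replace (2 * S m)%nat with (S (S (2 * m))) by lia.
      rewrite Cpow_S; cbn [Nat.eqb]; field; apply INR_fact_neq0.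
  + left; apply cradius_pos.
  + intros; apply holo_const.
- left; apply cradius_pos.
- intros z _; rewrite Cmult_0_r, Csinh_0; ring.
Qed.

Lemma Csinh_cpole (K j : nat) : Csinh (cpole K j) = 0.
Proof.
unfold Csinh, cpole.
replace (- (Ci * ((INR j - INR K) * PI)%R)) with (Ci * (- ((INR j - INR K) * PI))%R)
  by (rewrite RtoC_opp; ring).
rewrite !Cexp_imag, cos_neg, sin_neg.
replace (sin ((INR j - INR K) * PI)) with 0%R.
- rewrite Ropp_0; field; apply C2_neq0.
- symmetry; apply sin_eq_0_1; exists (Z.of_nat j - Z.of_nat K)%Z.
  now rewrite minus_IZR, <- !INR_IZR_INZ.
Qed.

Lemma defect_1 (K m : nat) : defect K (S m) 1 = 0.
Proof.
destruct (Lidstone0_spec _ (Even_double m)) as [_ D].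
destruct (D 0%nat) as [_ D1]; [now exists 0%nat |]; cbn [C_derive_n] in D1.
assert (P := cradius_pos K).
unfold defect, residue_part, contour_part, polynomial_part.
rewrite sum_n_0 by (intro j; rewrite Cmult_1_r, Csinh_cpole; ring).
rewrite (circle_int_ext _ (fun z => Ccosh z / z ^ S (2 * m))).
- rewrite circle_int_cosh_moment by exact P.
  rewrite D1.
  unfold cpow_fact; rewrite Cpow_1_l; generalize two_PI_Ci_neq0.
  generalize (2 * PI * Ci); intros q Hq; field.
  split; [apply INR_fact_neq0 | exact Hq].
- lra.
- intros z Hz; rewrite Cmult_1_r, pole_weight_S by (apply Cmod_pos_neq0; lra).
  unfold Ccoth; field; split.
  + apply Cpow_nz, Cmod_pos_neq0; lra.
  + now apply (Csinh_circ_neq0 K).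
Qed.

(** The case $m=0$ is the residue formula for $h(\zeta)=\zeta\sinh(\zeta z)$; the
    step is [ray_affine_zero], the second derivative being the previous defect. *)
Lemma defect_zero (K m : nat) (z : C) : defect K m z = 0.
Proof.
revert z; induction m as [|m IH]; intro z.
- assert (H : forall w, holo (fun w => w * Csinh (w * z))
    (fun w => 1 * Csinh (w * z) + w * (Ccosh (w * z) * (1 * z + w * 0))) w).
  { intro w; apply holo_mult; [apply holo_id |].
    apply (holo_Csinh (fun w => w * z)), holo_mult; [apply holo_id | apply holo_const]. }
  assert (R := circle_int_coth _ _ K H).
  unfold defect, contour_part, residue_part, polynomial_part.
  replace (circle_int (fun w => pole_weight 0 w * Csinh (w * z) * Ccoth w) (cradius K))
    with (circle_int (fun w => w * Csinh (w * z) * Ccoth w) (cradius K)).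
  + rewrite R.
    rewrite (sum_n_ext (fun j => pole_weight 0 (cpole K j) * Csinh (cpole K j * z))
      (fun j => cpole K j * Csinh (cpole K j * z))).
    * generalize two_PI_Ci_neq0; generalize (2 * PI * Ci); intros q Hq.
      field; exact Hq.
    * intro j; unfold pole_weight; simpl; toC; ring.
  + f_equal; apply functional_extensionality; intro w; unfold pole_weight; simpl; ring.
- destruct (polynomial_part_second_derive m) as [a [A1 A2]].
  destruct (residue_part_second_derive K m) as [b [B1 B2]].
  destruct (contour_part_second_derive K m) as [c [C1 C2]].
  assert (comb : forall p p' q q' s s' : C -> C,
    ray_derive p p' -> ray_derive q q' -> ray_derive s s' ->
    ray_derive (fun z => p z - q z + / (2 * PI * Ci) * s z)
               (fun z => p' z - q' z + / (2 * PI * Ci) * s' z)).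
  { intros p p' q q' s s' Hp Hq Hs.
    assert (N : forall f g : C -> C, (fun z => f z - g z) = (fun z => f z + - (1) * g z)).
    { intros f g; apply functional_extensionality; intro; ring. }
    apply (ray_derive_plus (fun z => p z - q z) (fun z => p' z - q' z)).
    - rewrite !N; apply ray_derive_plus, ray_derive_scal; assumption.
    - now apply ray_derive_scal. }
  refine (ray_affine_zero (defect K (S m)) _ (comb _ _ _ _ _ _ A1 B1 C1) _
    (defect_0 K m) (defect_1 K m) z).
  replace (fun _ : C => RtoC 0) with (defect K m).
  + exact (comb _ _ _ _ _ _ A2 B2 C2).
  + apply functional_extensionality, IH.
Qed.

(** * The sine sum *)

Lemma Csinh_opp (w : C) : Csinh (- w) = - Csinh w.
Proof.
unfold Csinh; replace (- - w) with w by ring; field; apply C2_neq0.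
Qed.

Lemma Csinh_Ci (w : C) : Csinh (Ci * w) = Ci * Csin w.
Proof. unfold Csinh, Csin; field; repeat split; auto using Ci_neq0, C2_neq0. Qed.

Lemma pole_weight_opp (m : nat) (w : C) : pole_weight m (- w) = - pole_weight m w.
Proof.
unfold pole_weight; replace (- w * - w) with (w * w) by ring; ring.
Qed.

Lemma sum_n_head (f : nat -> C) (n : nat) :
  sum_n f (S n) = f O + sum_n (fun j => f (S j)) n.
Proof.
induction n as [|n IH].
- rewrite sum_Sn, !sum_O; reflexivity.
- rewrite sum_Sn, IH, (sum_Sn (fun j => f (S j))); symmetry; apply Cplus_assoc.
Qed.

(** The terms $K+k$ and $K-k$ agree; passing from $K$ to $K+1$ adds one term at
    each end. *)
Lemma sum_n_even (H : R -> C) (K : nat) :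
  H 0%R = 0 -> (forall x, H (- x)%R = H x) ->
  sum_n (fun j => H (INR j - INR K)%R) (2 * K) =
  2 * sum_n_m (fun k => H (INR k)) 1 K.
Proof.
intros H0 He; induction K as [|K IH].
- rewrite sum_n_m_zero by lia; rewrite Nat.mul_0_r, sum_O, Rminus_diag, H0.
  change zero with (RtoC 0); toC; ring.
- replace (2 * S K)%nat with (S (S (2 * K))) by lia.
  rewrite sum_Sn, sum_n_head.
  rewrite (sum_n_ext _ (fun j => H (INR j - INR K)%R))
    by (intro j; rewrite !S_INR; f_equal; ring).
  rewrite IH, sum_n_Sm by lia.
  replace (INR 0 - INR (S K))%R with (- INR (S K))%R by (simpl INR; ring).
  replace (INR (S (S (2 * K))) - INR (S K))%R with (INR (S K))
    by (rewrite !S_INR, mult_INR; simpl INR; ring).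
  rewrite He.
  change (@plus C_AbelianMonoid) with Cplus; toC; ring.
Qed.

Lemma Cpow_m1_sqr (m : nat) : (- (1)) ^ m * (- (1)) ^ m = 1.
Proof.
induction m as [|m IH]; [simpl; ring |].
rewrite Cpow_S; transitivity ((- (1)) ^ m * (- (1)) ^ m); [ring | exact IH].
Qed.

Lemma Ci_pow_odd (m : nat) : Ci ^ S (2 * m) = Ci * (- (1)) ^ m.
Proof.
induction m as [|m IH]; [simpl; ring |].
replace (2 * S m)%nat with (S (S (2 * m))) by lia.
rewrite !(Cpow_S Ci (S _)), IH, Cpow_S, Cmult_assoc, Ci2; ring.
Qed.

(** At $p=\mathrm{i}k\pi$ the summand is
    $(\mathrm{i}k\pi)^{-2m-1}\,\mathrm{i}\sin(k\pi z)=(-1)^m(k\pi)^{-2m-1}\sin(k\pi z)$, which is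
    even in $k$ and vanishes for $k=0$. *)
Lemma residue_part_sin (K m : nat) (z : C) :
  residue_part K (S m) z =
  (- (1)) ^ m * (2 / PI ^ S (2 * m)) *
  sum_n_m (fun k => 1 / INR k ^ S (2 * m) * Csin (INR k * PI * z)) 1 K.
Proof.
unfold residue_part, cpole.
rewrite (sum_n_even (fun x => pole_weight (S m) (Ci * (x * PI)%R) *
   Csinh (Ci * (x * PI)%R * z))).
- rewrite (sum_n_m_ext_loc _ (fun k => mult (K := C_Ring) ((- (1)) ^ m / PI ^ S (2 * m))
    (1 / INR k ^ S (2 * m) * Csin (INR k * PI * z)))).
  + rewrite (sum_n_m_mult_l (K := C_Ring)).
    change (@mult C_Ring) with Cmult.
    match goal with |- _ * (_ * ?A) = _ * ?B => change A with B; generalize B end.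
    intro q; toC; unfold Cdiv; ring.
  + intros k [Hk _]; change (@mult C_Ring) with Cmult.
    assert (P0 : RtoC PI <> 0).
    { intro E; apply RtoC_inj in E; generalize PI_RGT_0; lra. }
    assert (k0 : RtoC (INR k) <> 0).
    { destruct k; [lia | apply INR_S_neq0]. }
    rewrite RtoC_mult, pole_weight_S by auto using Cmult_neq_0, Ci_neq0.
    replace (Ci * (INR k * PI) * z) with (Ci * (INR k * PI * z)) by ring.
    rewrite Csinh_Ci, !Cpow_mult_l, Ci_pow_odd.
    assert (M := Cpow_m1_sqr m).
    assert (M0 : (- (1)) ^ m <> 0).
    { intro E; rewrite E, Cmult_0_l in M; apply RtoC_inj in M; lra. }
    assert (Pn := Cpow_nz _ (S (2 * m)) P0); assert (kn := Cpow_nz _ (S (2 * m)) k0).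
    revert M M0 Pn kn.
    generalize ((- (1)) ^ m), (RtoC PI ^ S (2 * m)), (RtoC (INR k) ^ S (2 * m)),
      (Csin (INR k * PI * z)).
    intros e a b s M M0 Pn kn.
    transitivity (s / (b * a) * (1 / e)).
    * toC; field; repeat split; auto using Ci_neq0.
    * replace (1 / e) with e by (rewrite <- M; field; exact M0).
      toC; field; auto.
- replace (Ci * (0 * PI)%R) with (RtoC 0) by (rewrite Rmult_0_l; ring).
  unfold pole_weight; toC; ring.
- intro x; replace (Ci * (- x * PI)%R) with (- (Ci * (x * PI)%R))
    by (rewrite !RtoC_mult, RtoC_opp; ring).
  rewrite pole_weight_opp.
  replace (- (Ci * (x * PI)%R) * z) with (- (Ci * (x * PI)%R * z)) by ring.
  rewrite Csinh_opp; toC; ring.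
Qed.

Theorem proposition2 :
  forall (t : nat) (K : nat) (z : C), Nat.Even t ->
    Lidstone0 t z =
      z ^ t / INR (fact t)
      + (- (1)) ^ (t / 2) * (2 / PI ^ (t + 1))
          * sum_n_m (fun k : nat => 1 / INR k ^ (t + 1) * Csin (INR k * PI * z)) 1 K
      - 1 / (2 * PI * Ci)
          * circle_int (fun zeta : C => / zeta ^ (t + 1) * Csinh (zeta * z) * Ccoth zeta)
              ((2 * INR K + 1) * PI / 2).
Proof.
intros t K z [m ->].
assert (D := defect_zero K (S m) z); unfold defect, polynomial_part in D.
rewrite Nat.add_1_r, (Nat.mul_comm 2 m), Nat.div_mul, (Nat.mul_comm m 2) by lia.
rewrite <- residue_part_sin.
fold (cradius K); fold (cpow_fact (2 * m) z).
replace (circle_int _ (cradius K)) with (contour_part K (S m) z).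
- replace (Lidstone0 (2 * m) z) with
    (Lidstone0 (2 * m) z - cpow_fact (2 * m) z - residue_part K (S m) z
      + / (2 * PI * Ci) * contour_part K (S m) z
      + (cpow_fact (2 * m) z + residue_part K (S m) z
         - / (2 * PI * Ci) * contour_part K (S m) z)) by ring.
  rewrite D; unfold Cdiv; ring.
- assert (P := cradius_pos K).
  apply circle_int_ext; [lra |]; intros w Hw.
  now rewrite pole_weight_S by (apply Cmod_pos_neq0; lra).
Qed.
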